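(* Let $\psi:\mathbb{N}\to\mathbb{R}$ be a non-negative arithmetical function such that for some $c>0$ the series \[ \sum_{n=16}^{\infty} \frac{\varphi(n)\, \psi(n)}{n \exp\big(c(\log \log n)(\log \log \log n)\big)} \] diverges. Then the Duffin–Schaeffer Conjecture holds for $\psi$, that is, $\lambda(W(\psi))=1$ if and only if $\sum_{n=1}^\infty \frac{\varphi(n)}{n}\psi(n)$ diverges.
   Context: $\varphi$ denotes Euler's totient function and $\lambda$ denotes Lebesgue measure on $\mathbb{R}/\mathbb{Z}$. For each positive integer $n$, define $\mathcal{E}_n\subseteq\mathbb{R}/\mathbb{Z}$ by \[ \mathcal{E}_n := \bigcup_{\substack{a=1\\ \gcd(a,n)=1}}^{n}\left(\frac{a-\psi(n)}{n},\frac{a+\psi(n)}{n}\right), \] and let $W(\psi):=\limsup_{n\to\infty}\mathcal{E}_n=\bigcap_{m=1}^\infty\bigcup_{n\ge m}\mathcal{E}_n$, the set of points of $\mathbb{R}/\mathbb{Z}$ lying in infinitely many of the sets $\mathcal{E}_n$. *)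

(* Defs.v *)
From mathcomp Require Import all_boot all_order all_algebra archimedean.
From mathcomp Require Import generic_quotient ring_quotient.
From mathcomp Require Import all_classical all_reals all_analysis.

Set Implicit Arguments.
Unset Strict Implicit.
Unset Printing Implicit Defensive.

Import Order.TTheory GRing.Theory Num.Theory.
Import numFieldNormedType.Exports.

Local Open Scope classical_set_scope.
Local Open Scope ring_scope.
Local Open Scope quotient_scope.

(* [int_num_subdef] is the predicate underlying the qualifier [Num.int], and the
   one that carries the additive subgroup structure. *)
Definition integers (R : realType) : zmodClosed R :=
  [the zmodClosed R of @Num.int_num_subdef R : {pred R}].

Definition circle (R : realType) := Quotient.quot (integers R).

Definition to_circle (R : realType) (x : R) : circle R := \pi_(circle R) x.

(* [0, 1[ is a fundamental domain for R / Z: Lebesgue measure on R / Z is the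
   image under the projection of Lebesgue measure on [0, 1[. *)
Definition circle_measure (R : realType) (A : set (circle R)) : \bar R :=
  lebesgue_measure (`[0%R, 1%R[%classic `&` @to_circle R @^-1` A).

(* The intervals are taken in R and then projected, so they may wrap around
   (or cover) the circle. *)
Definition approx_set (R : realType) (psi : nat -> R) (n : nat) :
    set (circle R) :=
  \bigcup_(a in [set a : nat | (1 <= a <= n)%N && coprime a n])
    (@to_circle R @`
      `](a%:R - psi n) / n%:R, (a%:R + psi n) / n%:R[%classic).

(* The index 0 is harmless: approx_set psi 0 is empty. *)
Definition well_approximable (R : realType) (psi : nat -> R) :
    set (circle R) :=
  lim_sup_set (approx_set psi).

(* Main.v *)
Require Import Defs.
From mathcomp Require Import all_boot all_order all_algebra.
From mathcomp Require Import all_classical all_reals all_analysis.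
From mathcomp Require Import measurable_realfun.
From mathcomp Require Import ring lra zify.

(* The series in the hypothesis is dominated by the one in the conclusion, so only full measure
   is at stake.  Cut the integers into blocks [2^(2^h), 2^(2^(h+1))).  For m, n in one block, the
   overlap of the approximation sets is at most a constant times the product of their measures
   and 1 + h/log X, where X measures psi(m) n + psi(n) m in units of gcd(m, n); this is a sieve
   bound, proved from the Chinese remainder theorem, Mertens' estimates and the Hall-Tenenbaum
   inequality.  Replacing psi by psi/2^k for k < K and averaging over k, the factor becomes
   1 + h log K / K, which is bounded for K ~ h log h; so some scale k gives quasi-independence
   on average.  The extra exponential in the hypothesis makes the block sums exceed 2^K
   infinitely often, hence at the good scale they are still at least 1, and the second moment
   method gives a limsup set of measure at least some constant depending only on c.

   Full measure is obtained from 2-adic valuations instead of Gallagher's theorem.  If the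
   divergence already happens on {n : v_2(n) = v}, then x |-> 2x + 2^-v maps the limsup set of
   psi into that of 2 psi; since psi may be multiplied by a slowly growing factor, this yields a
   forward invariant subset of positive measure, which has full measure by Lebesgue density.
   Otherwise it happens on {n : v_2(n) > j} for every j, and the limsup set contains, for each
   j, a subset of period 2^-j of measure bounded below, so its complement has no density
   point. *)

Set Implicit Arguments.
Unset Strict Implicit.
Unset Printing Implicit Defensive.

Import Order.TTheory GRing.Theory Num.Theory.
Import numFieldNormedType.Exports.

Local Open Scope classical_set_scope.
Local Open Scope ring_scope.

(** * Totients and prime power sums *)

(** The obstacle is the loss [1 + h / log X]: a short sum over [r] does not average out the primes
    between [X] and about [2^h], so for bounded [X] the loss has order [h]. Primes beyond [2^h] are
    harmless, since an integer below [2^(2^(h+2))] has at most [2^(h+2)] prime factors; this is why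
    the blocks are doubly exponential. In a block, [h] is about [log log n], so [2^K] with
    [K = h log h / q] has the shape of the exponential in the hypothesis; [q] is chosen from [c] and
    enters the quasi-independence constant linearly.

    Since [2 h] is small against [h log h], there is also room to divide [psi] by [2^h] on block
    [h]. Then for each fixed [j] the function [2^j psi / 2^h] is eventually below [psi], which is
    the freedom that the doubling argument uses up one factor 2 at a time. The lower bound for the
    measure depends on [q] only, and is the same for every restriction of [psi] that keeps the
    damped series divergent; the argument with period [2^-j] rests on this uniformity.

    The analysis takes place on 1-periodic subsets of the line; the circle returns only at the
    end. *)

Definition primefactor (R : realType) (p : nat) : R := 1 - p%:R^-1.

Definition phi_ratio (R : realType) (n : nat) : R := (totient n)%:R / n%:R.

Section PrimeFactor.
Variable R : realType.
Local Notation u := (@primefactor R).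
Local Notation rho := (@phi_ratio R).

Lemma primefactorE p : (0 < p)%N -> u p = p.-1%:R / p%:R.
Proof.
move=> p0; rewrite /primefactor -subn1 natrB// mulrBl divff ?mul1r//.
by rewrite pnatr_eq0 -lt0n.
Qed.

Lemma primefactor_ge_half p : prime p -> 2^-1 <= u p.
Proof.
move=> /prime_gt1 p1; rewrite /primefactor lerBrDr -lerBrDl.
rewrite (_ : 1 - 2^-1 = 2^-1 :> R); last lra.
by rewrite lef_pV2 ?posrE ?ltr0n ?ler_nat// ltnW.
Qed.

Lemma primefactor_gt0 p : prime p -> 0 < u p.
Proof. by move=> /primefactor_ge_half; apply: lt_le_trans; rewrite invr_gt0. Qed.

Lemma primefactor_le1 p : u p <= 1.
Proof. by rewrite /primefactor lerBlDr lerDl invr_ge0. Qed.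

(** Euler's product, padded with trivial factors up to an arbitrary bound [N], so that the products
    of several integers can be compared prime by prime over one range. *)
Lemma phi_ratioE n N : (0 < n < N)%N ->
  rho n = \prod_(0 <= p < N | prime p) (if (p %| n)%N then u p else 1).
Proof.
move=> /andP[n0 nN].
rewrite -big_mkcondr /= /phi_ratio (totientE n0).
have primesE : primes n = [seq p <- index_iota 0 N | prime p && (p %| n)%N].
  rewrite -(filter_pi_of nN); apply: eq_in_filter => p _.
  by rewrite [LHS](mem_primes p n) n0.
rewrite -[RHS]big_filter -primesE.
have -> : (n%:R : R) = (\prod_(p <- primes n) p ^ logn p n)%:R.
  congr (_%:R); rewrite [LHS](prod_prime_decomp n0) prime_decompE big_map.
  by apply: eq_bigr.
rewrite !natr_prod -prodf_div; apply: eq_big_seq => p.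
rewrite -logn_gt0 => lp.
have p0 : (0 < p)%N by move: lp; rewrite logn_gt0 mem_primes => /andP[/prime_gt0].
have pR : p%:R != 0 :> R by rewrite pnatr_eq0 -lt0n.
rewrite primefactorE// -{2}(prednK lp) expnS !natrM invfM mulrACA.
by rewrite divff ?mulr1// pnatr_eq0 -lt0n expn_gt0 p0.
Qed.

Lemma phi_ratio_gt0 n : (0 < n)%N -> 0 < rho n.
Proof. by move=> n0; rewrite divr_gt0// ltr0n// totient_gt0. Qed.

Lemma phi_ratio_ge0 n : 0 <= rho n.
Proof. by rewrite divr_ge0. Qed.

Lemma phi_ratio_prime_mul p s : prime p -> (0 < s)%N ->
  rho (p * s) = if (p %| s)%N then rho s else u p * rho s.
Proof.
move=> pp s0; have p0 := prime_gt0 pp.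
have pN : (p < (p * s).+1)%N by rewrite ltnS leq_pmulr.
rewrite (@phi_ratioE _ (p * s).+1) ?muln_gt0 ?p0 ?s0/=//.
rewrite (@phi_ratioE s (p * s).+1) ?s0/= ?ltnS ?leq_pmull//.
have pin : p \in index_iota 0 (p * s).+1 by rewrite mem_index_iota.
rewrite [LHS]big_mkcond [in RHS]big_mkcond/=.
rewrite [LHS](bigD1_seq p pin (iota_uniq _ _))/= pp dvdn_mulr//.
have E : \prod_(0 <= i < (p * s).+1 | i != p)
      (if prime i then if (i %| p * s)%N then u i else 1 else 1) =
   \prod_(0 <= i < (p * s).+1 | i != p)
      (if prime i then if (i %| s)%N then u i else 1 else 1).
  apply: eq_bigr => q qnp; case: ifP => // qp.
  by rewrite Gauss_dvdr// prime_coprime// dvdn_prime2.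
rewrite E (bigD1_seq (F := fun i => if prime i then if (i %| s)%N then u i else 1 else 1)
  p pin (iota_uniq _ _))/= pp.
by case: (p %| s)%N; rewrite ?mul1r.
Qed.

(** Only the first factor [p] can change the ratio, and it does so by [1 - 1/p >= 1/2]. This is the
    growth condition that [sum_le_log_mean] asks of [1 / rho]. *)
Lemma phi_ratio_prime_power_mul p k s : prime p -> (0 < k)%N -> (0 < s)%N ->
  rho s <= 2 * rho (p ^ k * s).
Proof.
move=> pp; case: k => // k _ s0.
have -> : rho (p ^ k.+1 * s) = rho (p * s).
  elim: k => [|k <-]; first by rewrite expn1.
  rewrite [in LHS]expnS -mulnA phi_ratio_prime_mul//.
    by rewrite expnS -mulnA dvdn_mulr.
  by rewrite muln_gt0 s0 expn_gt0 prime_gt0.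
rewrite phi_ratio_prime_mul//; case: ifP => _.
  by rewrite ler_peMl ?phi_ratio_ge0// ler1n.
by rewrite mulrA ler_peMl ?phi_ratio_ge0//; have := primefactor_ge_half pp; lra.
Qed.

End PrimeFactor.

(* The sum of [F] against the von Mangoldt function, over the prime powers with base and exponent below [N] *)
Definition ppsum (R : realType) (N : nat) (F : nat -> R) : R :=
  \sum_(0 <= p < N | prime p) \sum_(1 <= k < N) ln p%:R * F (p ^ k)%N.

Section PrimePowerSums.
Variable R : realType.
Implicit Types (F G : nat -> R).

Lemma ln_prime_ge0 p : prime p -> 0 <= ln p%:R :> R.
Proof. by move=> /prime_gt0 p0; rewrite ln_ge0// ler1n. Qed.

Lemma ler_ppsum N F G : (forall p k, prime p -> (0 < k)%N -> F (p ^ k)%N <= G (p ^ k)%N) ->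
  ppsum N F <= ppsum N G.
Proof.
move=> FG; apply: ler_sum => p pp; rewrite big_nat_cond [leRHS]big_nat_cond.
apply: ler_sum => k /andP[/andP[k1 _] _].
by rewrite ler_wpM2l ?ln_prime_ge0// FG.
Qed.

Lemma ppsumD N F G : ppsum N (fun d => F d + G d) = ppsum N F + ppsum N G.
Proof.
rewrite /ppsum -big_split/=; apply: eq_bigr => p _.
by rewrite -big_split/=; apply: eq_bigr => k _; rewrite mulrDr.
Qed.

Lemma ppsumZ N a F : ppsum N (fun d => a * F d) = a * ppsum N F.
Proof.
rewrite /ppsum mulr_sumr; apply: eq_bigr => p _.
by rewrite mulr_sumr; apply: eq_bigr => k _; rewrite mulrCA.
Qed.

Lemma ppsum_sum (I : Type) (r : seq I) (P : pred I) N (F : I -> nat -> R) :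
  ppsum N (fun d => \sum_(i <- r | P i) F i d) = \sum_(i <- r | P i) ppsum N (F i).
Proof.
rewrite /ppsum [RHS]exchange_big/=; apply: eq_bigr => p _.
rewrite [RHS]exchange_big/=; apply: eq_bigr => k _.
by rewrite mulr_sumr.
Qed.

Lemma ln_prod_nat (I : eqType) (r : seq I) (P : pred I) (F : I -> R) :
  (forall i, P i -> 0 < F i) ->
  ln (\prod_(i <- r | P i) F i) = \sum_(i <- r | P i) ln (F i).
Proof.
move=> F0; elim: r => [|i r IH]; first by rewrite !big_nil ln1.
rewrite !big_cons; case: ifP => // Pi; rewrite lnM ?IH// posrE ?F0//.
by rewrite prodr_gt0.
Qed.

Lemma prod_prime_powers n N : (0 < n < N)%N ->
  n = (\prod_(0 <= p < N | prime p) p ^ logn p n)%N.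
Proof.
move=> /andP[n0 nN]; rewrite {1}(prod_prime_decomp n0) prime_decompE big_map/=.
have -> : primes n = [seq p <- index_iota 0 N | p \in primes n].
  by rewrite -[LHS](filter_pi_of nN).
rewrite big_filter big_mkcond [RHS]big_mkcond/=; apply: eq_bigr => p _.
rewrite mem_primes n0/=; case: ifP => [/andP[-> _]//|]; case: (boolP (prime p)) => //= pp.
by move=> pn; rewrite (_ : logn p n = 0%N)// lognE pp n0/= pn.
Qed.

(** The convolution identity of the von Mangoldt function: [ln p] is counted once for each [k] with
    [p ^ k] dividing [n], that is, [logn p n] times. *)
Lemma ln_ppsum N n : (0 < n < N)%N -> ln (n%:R : R) = ppsum N (fun d => (d %| n)%N%:R).
Proof.
move=> nN; rewrite {1}(prod_prime_powers nN) natr_prod ln_prod_nat; last first.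
  by move=> p pp; rewrite ltr0n expn_gt0 prime_gt0.
apply: eq_bigr => p pp; rewrite natrX lnXn ?ltr0n ?prime_gt0//.
rewrite -mulr_sumr -natr_sum -[LHS]mulr_natr; congr (_ * _%:R).
case/andP: nN => n0 nN; rewrite logn_count_dvd//.
rewrite [RHS](big_cat_nat _ (ltnW nN))//= [X in (_ + X)%N]big1_seq ?addn0//.
move=> k /=; rewrite mem_index_iota => /andP[nk _].
rewrite gtnNdvd//; apply: leq_ltn_trans nk _; exact: ltn_expl (prime_gt1 pp).
Qed.

Lemma natr_divn_sum n d : (0 < d)%N ->
  (n %/ d)%N%:R = \sum_(1 <= i < n.+1) (d %| i)%N%:R :> R.
Proof.
move=> d0; rewrite -natr_sum; congr (_%:R).
elim: n => [|n IH]; first by rewrite div0n big_geq.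
by rewrite big_nat_recr//= -IH divnS// addnC.
Qed.

(** Legendre's formula, with all primes collected into one sum over prime powers. *)
Lemma ln_fact_ppsum N n : (n < N)%N -> ln ((n`!)%:R : R) = ppsum N (fun d => (n %/ d)%N%:R).
Proof.
move=> nN; rewrite fact_prod natr_prod big_nat_cond ln_prod_nat; last first.
  by move=> i /andP[/andP[i1 _] _]; rewrite ltr0n.
transitivity (ppsum N (fun d => \sum_(1 <= i < n.+1) (d %| i)%N%:R : R)); last first.
  apply: eq_bigr => p pp; apply: eq_bigr => k _.
  by rewrite natr_divn_sum// expn_gt0 prime_gt0.
rewrite (ppsum_sum _ _ _ (fun i d : nat => (d %| i)%N%:R)).
rewrite [RHS]big_nat_cond; apply: eq_bigr => i /andP[/andP[i1 iN] _].
by apply: ln_ppsum; rewrite i1/=; lia.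
Qed.

Lemma ln_le_sub1 (x : R) : 0 < x -> ln x <= x - 1.
Proof.
have := @le_ln1Dx R (x - 1); rewrite [1 + _]addrC subrK => h x0; apply: h; lra.
Qed.

(** Induction by halving: in the logarithm of the central binomial [C(2n, n) <= 4^n], the prime
    power [d] has coefficient [floor(2n/d) - 2 floor(n/d)], which is nonnegative, and positive for
    [n < d <= 2n]. The constant 4 leaves room for the term [d = z] of an odd [z], which costs at
    most [ln z <= z - 1]. *)
Lemma chebyshev N z : (z < N)%N -> ppsum N (fun d => (d <= z)%N%:R) <= 4 * z%:R :> R.
Proof.
elim/ltn_ind: z => z IH zN; case: (posnP z) => [->|z0].
  rewrite mulr0 /ppsum big1// => p pp; apply: big1 => k _.
  by rewrite leqn0 expn_eq0 (gtn_eqF (prime_gt0 pp)) mulr0.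
set n := z./2.
have zE : z = (odd z + n.*2)%N by rewrite odd_double_half.
have nz : (n < z)%N by rewrite /n; lia.
have IHn := IH n nz (ltn_trans nz zN).
have n2 : (n.*2 < N)%N by lia.
have step : ppsum N (fun d => (d <= n.*2)%N%:R) <=
    ppsum N (fun d => (d <= n)%N%:R) + 2 * n%:R :> R.
  have -> : 2 * n%:R = n.*2%:R :> R by rewrite -muln2 natrM mulrC.
  have cb : ln 'C(n.*2, n)%:R <= n.*2%:R :> R.
    have bn : ('C(n.*2, n) <= 2 ^ n.*2)%N.
      rewrite -[2%N]/(1 + 1)%N Pascal (bigD1 (inord n))//= inordK; last by lia.
      by rewrite !exp1n !muln1 leq_addr.
    have : ln 'C(n.*2, n)%:R <= ln (2 ^ n.*2)%:R :> R.
      by rewrite ler_ln ?posrE ?ltr0n ?expn_gt0 ?bin_gt0 ?ler_nat// -addnn leq_addr.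
    move=> /le_trans; apply; rewrite natrX lnXn// -[X in X <= _]mulr_natl ler_piMr//.
    by have := @ln_le_sub1 2 ltac:(by []); lra.
  have cE : ln 'C(n.*2, n)%:R = ppsum N (fun d => (n.*2 %/ d)%N%:R) +
      (- 2) * ppsum N (fun d => (n %/ d)%N%:R) :> R.
    rewrite -!ln_fact_ppsum//; last by apply: leq_ltn_trans n2; rewrite -addnn leq_addr.
    have nn : (n <= n.*2)%N by rewrite -addnn leq_addr.
    rewrite -(bin_fact nn) -addnn addnK !natrM !lnM ?posrE ?ltr0n ?muln_gt0 ?fact_gt0 ?bin_gt0 ?leq_addr//.
    lra.
  rewrite -lerBlDl; apply: le_trans cb; rewrite cE -!ppsumZ -!ppsumD.
  rewrite -[X in _ - X]mul1r -mulNr -ppsumZ -ppsumD.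
  apply: ler_ppsum => p k pp k0; set d := (p ^ k)%N.
  have d0 : (0 < d)%N by rewrite expn_gt0 prime_gt0.
  have h : (2 * (n %/ d) + (d <= n.*2) <= n.*2 %/ d + (d <= n))%N.
    case: (leqP d n) => dn.
      have le2 : (2 * (n %/ d) <= n.*2 %/ d)%N.
        by rewrite leq_divRL// -mulnA -muln2 mulnC leq_mul2r leq_trunc_div orbT.
      by rewrite leq_add// leq_b1.
    rewrite divn_small// muln0 add0n addn0.
    case: (leqP d n.*2) => // dn2; rewrite divn_gt0//.
  have : (2 * (n %/ d) + (d <= n.*2))%:R <= (n.*2 %/ d + (d <= n))%:R :> R by rewrite ler_nat.
  rewrite [X in X <= _]natrD [X in _ <= X]natrD natrM; lra.
rewrite (_ : 4 * z%:R = 4 * (odd z)%:R + 8 * n%:R); last first.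
  by rewrite {1}zE natrD -muln2 natrM; lra.
move: zE; case: (boolP (odd z)) => oz; rewrite ?add0n ?add1n => zE; last first.
  have n0R : 0 <= n%:R :> R by [].
  by move: step; rewrite -zE mulr0; lra.
rewrite mulr1; have last_term : ppsum N (fun d => (d <= z)%N%:R) <=
    ppsum N (fun d => (d <= n.*2)%N%:R) + ln z%:R :> R.
  rewrite (@ln_ppsum N z) ?z0 ?zN// -ppsumD.
  apply: ler_ppsum => p k pp k0; set d := (p ^ k)%N.
  rewrite -natrD ler_nat; case: (leqP d n.*2) => dn; first exact: leq_trans (leq_b1 _) (leq_addr _ _).
  case: (leqP d z) => // dz; rewrite (_ : d = z) ?dvdnn//.
  by apply/eqP; rewrite eqn_leq dz zE.
have := @ln_le_sub1 z%:R; rewrite ltr0n => /(_ z0).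
by rewrite {2}zE -[in X in _ <= X -> _]addn1 natrD -muln2 natrM/=; lra.
Qed.

(** For [d <= n], [n / d <= floor(n / d) + 1]: the floors add up to [ln n! <= n ln n], and
    Chebyshev's bound pays for the rounding. *)
Lemma mertens_first n : (0 < n)%N ->
  ppsum n.+1 (fun d => (d <= n)%N%:R / d%:R) <= ln (n%:R : R) + 4.
Proof.
move=> n0; have nR : 0 < n%:R :> R by rewrite ltr0n.
rewrite -(ler_pM2l nR) -ppsumZ mulrDr.
have h1 : ln (n`!)%:R <= n%:R * ln n%:R :> R.
  rewrite mulr_natl -lnXn// -natrX ler_ln ?posrE ?ltr0n ?expn_gt0 ?n0 ?fact_gt0// ler_nat.
  elim: (n) => [//|m IH]; rewrite factS expnS leq_mul// (leq_trans IH)//.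
  by case: (m) => // m'; rewrite leq_exp2r.
have h2 := chebyshev (ltnSn n).
rewrite (ln_fact_ppsum (ltnSn n)) in h1.
apply: le_trans (lerD h1 (le_trans h2 _)); last by rewrite mulrC.
rewrite -ppsumD; apply: ler_ppsum => p k pp k0; set d := (p ^ k)%N.
have d0 : (0 < d)%N by rewrite expn_gt0 prime_gt0.
case: leqP => dn; last by rewrite mul0r mulr0 addr0.
rewrite mul1r ler_pdivrMr ?ltr0n// -natrD -natrM ler_nat addn1.
by rewrite ltnW// -ltn_divLR.
Qed.

End PrimePowerSums.

(** * Mertens' estimates *)

Section Mertens.
Variable R : realType.
Local Notation u := (@primefactor R).
Local Notation rho := (@phi_ratio R).

Lemma divr_succ (x a : R) : 0 < x -> a / x = a / (x + 1) + a / (x * (x + 1)).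
Proof.
move=> x0; have h1 : x != 0 by rewrite gt_eqF.
have h2 : x + 1 != 0 by rewrite gt_eqF// addr_gt0.
by field; rewrite h1 h2.
Qed.

Lemma ln2_ge_half : 2^-1 <= ln 2 :> R.
Proof.
have := @ln_le_sub1 R 2^-1 ltac:(lra).
by rewrite lnV ?posrE//; lra.
Qed.

Lemma harmonic_le_ln i : (0 < i)%N -> \sum_(1 <= j < i.+1) j%:R^-1 <= 1 + ln i%:R :> R.
Proof.
elim: i => // -[|i] IH _; first by rewrite big_nat1 invr1 ln1 addr0.
rewrite big_nat_recr//=.
have := IH isT.
have i0 : 0 < i.+1%:R :> R by [].
have i2 : 0 < i.+2%:R :> R by [].
have := @ln_le_sub1 R (i.+1%:R / i.+2%:R) (divr_gt0 i0 i2).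
rewrite ln_div ?posrE// (_ : i.+1%:R / i.+2%:R - 1 = - i.+2%:R^-1); last first.
  have : i.+2%:R != 0 :> R by [].
  by rewrite -[i.+2]addn1 -[i.+1]addn1 !natrD => h; field.
by move: (i.+2%:R^-1) => a; lra.
Qed.

Lemma inv_primefactor_le p : prime p -> (u p)^-1 <= expR (p.-1%:R^-1).
Proof.
move=> pp; have p0 := prime_gt0 pp; have p1 := prime_gt1 pp.
have q0 : 0 < p.-1%:R :> R by rewrite ltr0n; lia.
rewrite primefactorE// invf_div; apply: le_trans (expR_ge1Dx _).
by rewrite -{1}(prednK p0) -addn1 natrD mulrDl divff ?gt_eqF// mul1r.
Qed.

Lemma sum_inv_consecutive N :
  \sum_(0 <= p < N | prime p) (p%:R * p.-1%:R)^-1 <= 1 :> R.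
Proof.
case: N => [|N]; first by rewrite big_geq.
suff h : \sum_(0 <= p < N.+1 | prime p) (p%:R * p.-1%:R)^-1 <= 1 - N%:R^-1 :> R.
  by apply: le_trans h _; rewrite gerBl invr_ge0.
elim: N => [|[|N] IH]; first by rewrite big_mkcond big_nat_recr//= big_geq//= invr0 addr0 subr0.
  by rewrite big_mkcond !big_nat_recr//= big_geq//= !addr0 invr1 subrr.
rewrite big_mkcond big_nat_recr//= -big_mkcond/=.
have e : (N.+2%:R * N.+1%:R)^-1 = N.+1%:R^-1 - N.+2%:R^-1 :> R.
  have : N.+1%:R != 0 :> R by [].
  have : N.+2%:R != 0 :> R by [].
  by rewrite -[N.+2]addn1 -[N.+1]addn1 !natrD => h1 h2; field; rewrite h1 h2.
apply: (@le_trans _ _ (1 - N.+1%:R^-1 + (N.+2%:R * N.+1%:R)^-1)).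
  by rewrite lerD//; case: ifP => // _; rewrite invr_ge0 mulr_ge0.
by rewrite e addrA subrK.
Qed.

Let S N : R := \sum_(0 <= p < N | prime p) ln p%:R / p%:R.
Let B N : R := \sum_(0 <= p < N | prime p) p%:R^-1.

Lemma mertens_first_primes i : S (2 ^ i).+1 <= i%:R * ln 2 + 4.
Proof.
have n0 : (0 < 2 ^ i)%N by rewrite expn_gt0.
have := @mertens_first R (2 ^ i) n0; rewrite natrX lnXn// mulr_natl.
apply: le_trans; rewrite /S /ppsum.
rewrite big_nat_cond [leRHS]big_nat_cond; apply: ler_sum => p /andP[/andP[_ pN] pp].
rewrite big_ltn_cond/= ?ltnS// expn1 -ltnS pN mul1r lerDl sumr_ge0// => k _.
by rewrite mulr_ge0 ?ln_prime_ge0// divr_ge0.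
Qed.

(** Partial summation over dyadic ranges: primes in []2^i, 2^(i+1)]] have [ln p >= i ln 2].
    Replacing [S / i] by [S / (i+1)] leaves [S / (i (i+1))], which the bound [S <= (i+1) ln 2 + 4]
    turns into a harmonic term and the telescoping [4 / i - 4 / (i+1)]. *)
Lemma sum_inv_primes_step i : (0 < i)%N -> ln 2 * B (2 ^ i).+1 <=
  S (2 ^ i).+1 / i%:R + ln 2 * (\sum_(1 <= j < i) j%:R^-1) + 4 * (1 - i%:R^-1).
Proof.
elim: i => // -[|i] IH _.
  rewrite big_geq// invr1 subrr !mulr0 !addr0 mulr1 mulr_sumr /S.
  apply: ler_sum => p pp; rewrite ler_wpM2r// ler_ln ?posrE ?ltr0n ?ler_nat ?prime_gt1 ?prime_gt0//.
have i1 : 0 < i.+1%:R :> R by [].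
have i2 : 0 < i.+2%:R :> R by [].
have i0 : 0 <= i%:R :> R by [].
have le2 : ((2 ^ i.+1).+1 <= (2 ^ i.+2).+1)%N by rewrite ltnS leq_exp2l.
have SE : S (2 ^ i.+2).+1 = S (2 ^ i.+1).+1 + \sum_((2 ^ i.+1).+1 <= p < (2 ^ i.+2).+1 | prime p) ln p%:R / p%:R.
  by rewrite /S [LHS](big_cat_nat _ le2).
have BE : B (2 ^ i.+2).+1 = B (2 ^ i.+1).+1 + \sum_((2 ^ i.+1).+1 <= p < (2 ^ i.+2).+1 | prime p) p%:R^-1.
  by rewrite /B [LHS](big_cat_nat _ le2).
set s := (X in _ + X) in SE; set b := (X in _ + X) in BE.
have bs : ln 2 * b <= s / i.+1%:R.
  rewrite ler_pdivlMr// mulrAC /b /s mulr_sumr.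
  rewrite big_nat_cond [leRHS]big_nat_cond; apply: ler_sum => p /andP[/andP[pN _] pp].
  rewrite ler_wpM2r// mulr_natr -lnXn// ler_ln ?posrE ?exprn_gt0 ?ltr0n ?prime_gt0//.
  by rewrite -natrX ler_nat ltnW.
have := IH isT; have := mertens_first_primes i.+2.
have -> : \sum_(1 <= j < i.+2) j%:R^-1 = \sum_(1 <= j < i.+1) j%:R^-1 + i.+1%:R^-1 :> R.
  by rewrite big_nat_recr.
rewrite BE SE.
set S1 := S _; set B1 := B _; set H := \sum_(_ <= _ < _) _.
move=> hS hB; have E2 : i.+2%:R = i.+1%:R + 1 :> R by rewrite -[i.+2]addn1 natrD.
have k1 : (S1 + s) / i.+1%:R <= (S1 + s) / i.+2%:R + ln 2 / i.+1%:R + 4 / i.+1%:R - 4 / i.+2%:R.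
  have -> : (S1 + s) / i.+2%:R + ln 2 / i.+1%:R + 4 / i.+1%:R - 4 / i.+2%:R =
     (S1 + s) / i.+2%:R + (i.+2%:R * ln 2 + 4) / (i.+1%:R * i.+2%:R).
    by rewrite E2 (divr_succ 4 i1) (divr_succ (ln 2) i1); field; apply/andP; split; rewrite gt_eqF//; lra.
  rewrite {1}E2 (divr_succ _ i1) -E2.
  by rewrite lerD2l ler_wpM2r// invr_ge0 mulr_ge0// ltW.
clear -k1 hB bs; move: (i.+1%:R^-1) (i.+2%:R^-1) k1 hB bs => x y; lra.
Qed.

(** Division by [ln 2 >= 1/2] bounds the sum of [1 / p] by [10 + ln i]; passing from [1 / p] to
    [1 / (p - 1)] adds at most 1, hence 11. *)
Lemma mertens_product i : (0 < i)%N ->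
  \prod_(0 <= p < (2 ^ i).+1 | prime p) (u p)^-1 <= expR 11 * i%:R.
Proof.
move=> i0; have iR : 0 < i%:R :> R by rewrite ltr0n.
have Ble : B (2 ^ i).+1 <= 10 + ln i%:R.
  have l2 := ln2_ge_half; have l20 : 0 < ln 2 :> R by lra.
  rewrite -(ler_pM2l l20); apply: le_trans (sum_inv_primes_step i0) _.
  have h1 : \sum_(1 <= j < i) j%:R^-1 <= 1 + ln i%:R :> R.
    apply: le_trans (harmonic_le_ln i0).
    by rewrite [leRHS]big_nat_recr//= lerDl invr_ge0.
  have h2 : S (2 ^ i).+1 / i%:R <= ln 2 + 4 / i%:R.
    rewrite ler_pdivrMr// mulrDl divfK ?gt_eqF// mulrC; exact: mertens_first_primes.
  have h3 : ln 2 * (\sum_(1 <= j < i) j%:R^-1) <= ln 2 * (1 + ln i%:R) :> R.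
    by rewrite ler_pM2l.
  lra.
apply: (@le_trans _ _ (expR (\sum_(0 <= p < (2 ^ i).+1 | prime p) p.-1%:R^-1))).
  rewrite expR_sum; apply: ler_prod => p pp.
  by rewrite inv_primefactor_le// invr_ge0 ltW// primefactor_gt0.
rewrite -[i%:R in leRHS](lnK iR) -expRD ler_expR.
have := sum_inv_consecutive (2 ^ i).+1.
have -> : \sum_(0 <= p < (2 ^ i).+1 | prime p) p.-1%:R^-1 =
  B (2 ^ i).+1 + \sum_(0 <= p < (2 ^ i).+1 | prime p) (p%:R * p.-1%:R)^-1.
  rewrite /B -big_split/=; apply: eq_bigr => p pp.
  have p1 := prime_gt1 pp.
  have pR : p.-1%:R != 0 :> R by rewrite pnatr_eq0; lia.
  have pE : p%:R = p.-1%:R + 1 :> R by rewrite -{1}(prednK (prime_gt0 pp)) -addn1 natrD.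
  have q0 : 0 < p.-1%:R :> R by rewrite ltr0n; lia.
  by have := divr_succ 1 q0; rewrite !div1r -pE [p.-1%:R * _]mulrC.
lra.
Qed.

End Mertens.

Lemma sum_nat_dvdn (R : realType) d X (F : nat -> R) : (0 < d)%N ->
  \sum_(1 <= r < X.+1 | (d %| r)%N) F r = \sum_(1 <= s < (X %/ d).+1) F (d * s)%N.
Proof.
move=> d0; elim: X => [|X IH]; first by rewrite div0n !big_geq.
rewrite big_mkcond big_nat_recr//= -big_mkcond IH divnS//.
case: ifP => dX; last by rewrite addr0.
by rewrite add1n [RHS]big_nat_recr//= mulnC -(@divnK d X.+1)// divnS// dX add1n.
Qed.

(** * Mean values and a sieve bound *)

Section Sieve.
Variable R : realType.
Local Notation u := (@primefactor R).
Local Notation rho := (@phi_ratio R).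

(* Hall-Tenenbaum: write [ln r] as a sum of [ln p] over the prime powers dividing [r] *)
Lemma sum_le_log_mean (f : nat -> R) X : (0 < X)%N ->
  (forall r, 0 <= f r) ->
  (forall p k s, prime p -> (0 < k)%N -> (0 < s)%N -> f (p ^ k * s)%N <= 2 * f s) ->
  (1 + ln X%:R) * (\sum_(1 <= r < X.+1) f r) <=
    9 * X%:R * \sum_(1 <= r < X.+1) f r / r%:R.
Proof.
move=> X0 f0 f2.
(* For [r = d s] with [d] a prime power, [f r <= 2 f s], and for fixed [s] Chebyshev's bound over
   [d <= X / s] costs [4 X / s]: this gives 8. The ninth unit is [hrest], from
   [1 + ln (X / r) <= X / r]. *)
have hln : \sum_(1 <= r < X.+1) f r * ln r%:R <= 8 * X%:R * \sum_(1 <= r < X.+1) f r / r%:R.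
  have -> : \sum_(1 <= r < X.+1) f r * ln r%:R =
      ppsum X.+1 (fun d => \sum_(1 <= r < X.+1) f r * (d %| r)%N%:R).
    rewrite ppsum_sum big_nat_cond [RHS]big_nat_cond.
    apply: eq_bigr => r /andP[/andP[r1 rX] _].
    by rewrite ppsumZ -(@ln_ppsum R X.+1) ?r1.
  have le1 : ppsum X.+1 (fun d => \sum_(1 <= r < X.+1) f r * (d %| r)%N%:R) <=
      ppsum X.+1 (fun d => \sum_(1 <= s < X.+1) 2 * f s * (d <= X %/ s)%N%:R).
    apply: ler_ppsum => p k pp k0; have d0 : (0 < p ^ k)%N by rewrite expn_gt0 prime_gt0.
    have -> : \sum_(1 <= r < X.+1) f r * (p ^ k %| r)%N%:R =
        \sum_(1 <= r < X.+1 | (p ^ k %| r)%N) f r.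
      by rewrite [RHS]big_mkcond; apply: eq_bigr => r _; case: ifP; rewrite ?mulr1 ?mulr0.
    have -> : \sum_(1 <= s < X.+1) 2 * f s * (p ^ k <= X %/ s)%N%:R =
        \sum_(1 <= s < X.+1 | (s < (X %/ p ^ k).+1)%N) 2 * f s.
      rewrite [RHS]big_mkcond; apply: eq_big_nat => s /andP[s1 _].
      by rewrite ltnS !leq_divRL// mulnC; case: ifP; rewrite ?mulr1 ?mulr0.
    rewrite -(@big_nat_widen _ _ _ 1 (X %/ p ^ k).+1 X.+1 xpredT) ?ltnS ?leq_div//.
    by rewrite sum_nat_dvdn//; apply: ler_sum_nat => s /andP[s1 _]; exact: f2.
  apply: le_trans le1 _; rewrite ppsum_sum mulr_sumr.
  rewrite big_nat_cond [leRHS]big_nat_cond; apply: ler_sum => s /andP[/andP[s1 _] _].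
  rewrite ppsumZ.
  have sX : (X %/ s < X.+1)%N by rewrite ltnS leq_div.
  have h2f : 0 <= 2 * f s by rewrite mulr_ge0.
  apply: le_trans (ler_wpM2l h2f (chebyshev R sX)) _.
  have : (X %/ s)%N%:R <= X%:R / s%:R :> R.
    by rewrite ler_pdivlMr ?ltr0n// -natrM ler_nat leq_trunc_div.
  by have := f0 s; move: (X %/ s)%N%:R => z fs; nra.
have hrest : \sum_(1 <= r < X.+1) f r * (1 + ln X%:R - ln r%:R) <=
    X%:R * \sum_(1 <= r < X.+1) f r / r%:R.
  rewrite mulr_sumr big_nat_cond [leRHS]big_nat_cond.
  apply: ler_sum => r /andP[/andP[r1 _] _].
  rewrite mulrCA ler_wpM2l// -addrA -ln_div ?posrE ?ltr0n//.
  have : 0 < X%:R / r%:R :> R by rewrite divr_gt0 ?ltr0n.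
  by move=> /ln_le_sub1; lra.
have -> : (1 + ln X%:R) * (\sum_(1 <= r < X.+1) f r) =
   \sum_(1 <= r < X.+1) f r * ln r%:R + \sum_(1 <= r < X.+1) f r * (1 + ln X%:R - ln r%:R).
  rewrite -big_split/= mulr_sumr; apply: eq_bigr => r _.
  by rewrite mulrC -mulrDr; congr (_ * _); lra.
by move: hln hrest; lra.
Qed.

Lemma inv_totient_prime_mul p s : prime p -> (0 < s)%N ->
  (totient (p * s))%:R^-1 =
    (if (p %| s)%N then p%:R^-1 else p.-1%:R^-1) * (totient s)%:R^-1 :> R.
Proof.
move=> pp s0.
have -> : totient (p * s) = ((if (p %| s)%N then p else p.-1) * totient s)%N.
  case: ifP => ps; last by rewrite -(totient_prime pp) totient_coprime// prime_coprime// ps.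
  have := phi_ratio_prime_mul R pp s0; rewrite ps /phi_ratio.
  have pR : p%:R != 0 :> R by rewrite pnatr_eq0 -lt0n prime_gt0.
  have sR : s%:R != 0 :> R by rewrite pnatr_eq0 -lt0n.
  rewrite natrM => /(congr1 (fun x => x * (p%:R * s%:R))).
  rewrite divfK ?mulf_neq0// mulrCA divfK// -natrM => /eqP; rewrite eqr_nat => /eqP ->.
  by rewrite mulnC.
by rewrite natrM invfM; case: ifP.
Qed.

Lemma all_primes_mul (D : pred nat) p s : prime p -> (0 < s)%N ->
  all D (primes (p * s)) = D p && all D (primes s).
Proof.
move=> pp s0; have p0 := prime_gt0 pp.
have E q : (q \in primes (p * s)) = (q == p) || (q \in primes s).
  rewrite !mem_primes muln_gt0 p0 s0/=; case: (boolP (prime q)) => qp /=.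
    by rewrite Euclid_dvdM// dvdn_prime2.
  by case: eqP => // qE; rewrite qE pp in qp.
apply/allP/andP => [h|[Dp /allP h] q].
  split; first by apply: h; rewrite E eqxx.
  by apply/allP => q qs; apply: h; rewrite E qs orbT.
by rewrite E => /orP[/eqP ->//|]; exact: h.
Qed.

(** The factor is the full local series of [1 / totient (p ^ k)]. Infinite series are avoided: for
    the prime [N], removing one factor [N] from its multiples gives [H1 <= H1 / N + H0 / (N - 1)],
    where [H1] is the sum over multiples of [N] and [H0] the rest, and this is solved for [H1]. *)
Lemma sum_inv_totient_euler (D : pred nat) X N :
  \sum_(1 <= r < X.+1 | all (fun p => (p < N)%N && D p) (primes r)) (totient r)%:R^-1
   <= \prod_(0 <= p < N | prime p && D p) (1 + p%:R / p.-1%:R ^+ 2) :> R.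
Proof.
elim: N => [|N IH].
  rewrite big_geq//; case: X => [|X]; first by rewrite big_geq.
  rewrite big_mkcond big_ltn//= [X in _ + X]big1_seq ?addr0 ?invr1//.
  move=> r; rewrite mem_index_iota => /andP[_ /andP[r2 _]].
  case: (primes r) (primes_eq0 r) => [/=|//]; rewrite eqxx => /esym; lia.
set c := fun M => fun r => all (fun p => (p < M)%N && D p) (primes r).
rewrite -/(c N.+1) in IH *; rewrite -/(c N) in IH.
rewrite [leRHS]big_mkcond [leRHS]big_nat_recr//= -big_mkcond.
case: (boolP (prime N && D N)) => ND; last first.
  rewrite mulr1; apply: le_trans IH.
  rewrite le_eqVlt; apply/orP; left; apply/eqP; apply: eq_bigl => r.
  apply: eq_in_all => p; rewrite mem_primes => /andP[pp _].
  rewrite ltnS leq_eqVlt; case: eqVneq => //= pN; rewrite pN ltnn/=.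
  by apply/negbTE; apply: contra ND; rewrite -pN pp.
move/andP: ND => [pN DN]; have N1 := prime_gt1 pN.
rewrite (bigID (fun r => N %| r)%N)/= addrC.
set H0 := (X in X + _); set H1 := (X in _ + X).
have H0le : H0 <= \prod_(0 <= p < N | prime p && D p) (1 + p%:R / p.-1%:R ^+ 2).
  apply: le_trans IH; rewrite /H0 big_mkcond [leRHS]big_mkcond; apply: ler_sum_nat => r /andP[r1 _].
  case: ifP => [/andP[cr Nr]|_]; last by case: ifP => // _; rewrite invr_ge0.
  rewrite ifT//; apply/allP => p pr; move/allP: cr => /(_ _ pr) /andP[pN' ->].
  rewrite andbT ltn_neqAle -ltnS pN' andbT; apply: contraNneq Nr => <-.
  by move: pr; rewrite mem_primes => /and3P[].
have H00 : 0 <= H0 by apply: sumr_ge0 => r _; rewrite invr_ge0.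
have H10 : 0 <= H1 by apply: sumr_ge0 => r _; rewrite invr_ge0.
have H1le : H1 <= H1 / N%:R + H0 / N.-1%:R.
  pose w r : R := if c N.+1 r then (if (N %| r)%N then N%:R^-1 else N.-1%:R^-1) / (totient r)%:R else 0.
  have w0 r : 0 <= w r.
    by rewrite /w; case: ifP => // _; rewrite mulr_ge0 ?invr_ge0//; case: ifP => _; rewrite invr_ge0.
  have -> : H1 / N%:R + H0 / N.-1%:R = \sum_(1 <= r < X.+1) w r.
    rewrite /H1 /H0 !mulr_suml [X in X + _]big_mkcond [X in _ + X]big_mkcond -big_split/=.
    apply: eq_bigr => r _; rewrite /w -/(c N.+1 r); case: (c N.+1 r); case: (N %| r)%N => //=; rewrite ?addr0 ?add0r// mulrC//.
  have -> : H1 = \sum_(1 <= s < (X %/ N).+1) w s.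
    rewrite /H1 (eq_bigl (fun r => (N %| r)%N && c N.+1 r)); last by move=> r; rewrite andbC.
    rewrite big_mkcondr sum_nat_dvdn ?prime_gt0//; apply: eq_big_nat => s /andP[s1 _].
    by rewrite /w /c all_primes_mul// ltnS leqnn DN/= inv_totient_prime_mul.
  have NX : ((X %/ N).+1 <= X.+1)%N by rewrite ltnS leq_div.
  rewrite [leRHS](big_cat_nat _ NX)//= lerDl; apply: sumr_ge0 => r _; exact: w0.
have NR : N%:R = N.-1%:R + 1 :> R by rewrite -{1}(prednK (prime_gt0 pN)) -addn1 natrD.
have N0 : 0 < N.-1%:R :> R by rewrite ltr0n; lia.
apply: le_trans (ler_wpM2r _ H0le); last by rewrite addr_ge0// divr_ge0// exprn_ge0.
rewrite NR in H1le *; move: (N.-1%:R) N0 H1le => x x0 H1le.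
have x1 : 0 < x + 1 by lra.
suff : H1 <= H0 * ((x + 1) / x ^+ 2) by lra.
have : H1 * (x / (x + 1)) <= H0 / x.
  have -> : H1 * (x / (x + 1)) = H1 - H1 / (x + 1) by field; rewrite gt_eqF.
  lra.
rewrite -(ler_pM2r (_ : 0 < (x + 1) / x)) ?divr_gt0//.
have -> : H1 * (x / (x + 1)) * ((x + 1) / x) = H1 by field; rewrite !gt_eqF.
by move=> /le_trans; apply; rewrite le_eqVlt; apply/orP; left; apply/eqP; field; rewrite gt_eqF.
Qed.

End Sieve.

Section SieveBound.
Variable R : realType.
Local Notation u := (@primefactor R).
Local Notation rho := (@phi_ratio R).

Lemma expn_size_primes Q : (0 < Q)%N -> (2 ^ size (primes Q) <= Q)%N.
Proof.
move=> Q0; rewrite [leqRHS](prod_prime_decomp Q0) prime_decompE big_map/=.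
have : {subset primes Q <= primes Q} by [].
elim: {1 3 4}(primes Q) => [|p s IH]/=; first by rewrite big_nil.
move=> sQ; have pQ : p \in primes Q by rewrite sQ// inE eqxx.
rewrite big_cons expnS leq_mul//; last by apply: IH => q qs; rewrite sQ// inE qs orbT.
have := pQ; rewrite mem_primes => /and3P[/prime_gt1 p1 _ _].
by rewrite (leq_trans p1)// -{1}(expn1 p) leq_exp2l// logn_gt0.
Qed.

(** There are at most [2^(h+2)] prime divisors, and each one beyond [2^i >= 2^h] contributes at most
    [exp (2^-i)]. *)
Lemma prod_large_prime_divisors Q h i N : (0 < Q)%N -> (Q < 2 ^ (2 ^ h.+2))%N -> (h <= i)%N ->
  \prod_((2 ^ i).+1 <= p < N | prime p && (p %| Q)%N) (u p)^-1 <= expR 4.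
Proof.
move=> Q0 Qh hi.
apply: (@le_trans _ _ (expR (\sum_((2 ^ i).+1 <= p < N | prime p && (p %| Q)%N) (2 ^ i)%:R^-1))).
  rewrite expR_sum big_nat_cond [leRHS]big_nat_cond.
  apply: ler_prod => p /andP[/andP[ip _] /andP[pp _]].
  rewrite invr_ge0 ltW ?primefactor_gt0//=; apply: le_trans (inv_primefactor_le R pp) _.
  have p1 := prime_gt1 pp.
  by rewrite ler_expR lef_pV2 ?posrE ?ltr0n ?expn_gt0 ?ler_nat//; lia.
rewrite ler_expR.
have hs : (size (primes Q) <= 2 ^ h.+2)%N.
  by rewrite -(@leq_exp2l 2)//; apply: leq_trans (expn_size_primes Q0) (ltnW Qh).
rewrite big_const_seq iter_addr_0 -[leLHS]mulr_natl.
have cnt : (count (fun p => prime p && (p %| Q)%N) (index_iota (2 ^ i).+1 N) <= 2 ^ h.+2)%N.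
  apply: leq_trans hs; rewrite -size_filter; apply: uniq_leq_size.
    by rewrite filter_uniq// iota_uniq.
  by move=> p; rewrite mem_filter mem_primes Q0 => /andP[].
rewrite ler_pdivrMr ?ltr0n ?expn_gt0// -natrM ler_nat (leq_trans cnt)//.
by rewrite !expnS mulnA leq_mul2l leq_exp2l.
Qed.

(** [sum_le_log_mean] reduces to the sum of [1 / totient r], hence to an Euler product over the
    primes below [N] not dividing [Q]; Mertens bounds it by [i * rho Q], and
    [1 + ln X >= (j + 1) / 2] leaves the quotient [i / (j + 1)]. The exponent 16 is 11 from Mertens,
    4 from large divisors of [Q], and 1 from the second-order terms of the product. *)
Lemma coprime_sieve Q h X : (0 < Q)%N -> (Q < 2 ^ (2 ^ h.+2))%N -> (0 < X)%N ->
  \sum_(1 <= r < X.+1 | coprime r Q) (rho r)^-1 <=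
    18 * expR 16 * X%:R * rho Q * (1 + h%:R / (trunc_log 2 X).+1%:R).
Proof.
move=> Q0 Qh X0; set j := trunc_log 2 X.
(* The summand [j + 1] makes [N] exceed [X], so all prime factors of [r] are covered; the summand
   [h] makes the divisors of [Q] beyond [N] harmless. *)
pose i := (h + j.+1)%N; set N := (2 ^ i).+1; pose M := (N + Q.+1)%N.
have Xj : (X < 2 ^ j.+1)%N by exact: trunc_log_ltn.
have XN : (X < N)%N by rewrite ltnS ltnW// (leq_trans Xj)// leq_exp2l// leq_addl.
have XR : 0 < X%:R :> R by rewrite ltr0n.
set S := \sum_(_ <= _ < _ | _) _.
pose f r : R := if coprime r Q then (rho r)^-1 else 0.
have f0 r : 0 <= f r by rewrite /f; case: ifP => // _; rewrite invr_ge0 phi_ratio_ge0.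
have fM p k s : prime p -> (0 < k)%N -> (0 < s)%N -> f (p ^ k * s)%N <= 2 * f s.
  move=> pp k0 s0; rewrite /f coprimeMl; case: (coprime s Q); last by rewrite andbF mulr0.
  rewrite andbT; case: ifP => _; last by rewrite mulr_ge0// invr_ge0 phi_ratio_ge0.
  have s1 := phi_ratio_gt0 R s0.
  have s2 : 0 < rho (p ^ k * s) by rewrite phi_ratio_gt0// muln_gt0 s0 expn_gt0 prime_gt0.
  rewrite ler_pdivlMr// mulrC ler_pdivrMr//; exact: phi_ratio_prime_power_mul.
have SE : S = \sum_(1 <= r < X.+1) f r by rewrite /S big_mkcond.
have HT := sum_le_log_mean X0 f0 fM; rewrite -SE in HT.
pose D p := ~~ (p %| Q)%N.
have E1 : \sum_(1 <= r < X.+1) f r / r%:R <=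
    \prod_(0 <= p < N | prime p && D p) (1 + p%:R / p.-1%:R ^+ 2).
  apply: le_trans (sum_inv_totient_euler R D X N).
  rewrite [leRHS]big_mkcond; apply: ler_sum_nat => r /andP[r1 rX].
  rewrite /f; case: ifP => cr; last by rewrite mul0r; case: ifP => // _; rewrite invr_ge0.
  rewrite ifT; last first.
    apply/allP => p; rewrite mem_primes => /and3P[pp _ pr]; apply/andP; split.
      by apply: leq_ltn_trans (dvdn_leq r1 pr) _; apply: leq_ltn_trans XN; rewrite -ltnS.
    rewrite /D -prime_coprime//; exact: coprime_dvdl pr cr.
  by rewrite /phi_ratio invf_div mulrAC divff ?mul1r// pnatr_eq0 -lt0n.
have E2 : \prod_(0 <= p < N | prime p && D p) (1 + p%:R / p.-1%:R ^+ 2) <=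
    expR 1 * \prod_(0 <= p < N | prime p && D p) (u p)^-1.
  apply: (@le_trans _ _ (expR (\sum_(0 <= p < N | prime p && D p) (p%:R * p.-1%:R)^-1) *
      \prod_(0 <= p < N | prime p && D p) (u p)^-1)).
    rewrite expR_sum -big_split/=; apply: ler_prod => p /andP[pp _].
    have p1 := prime_gt1 pp; have q0 : 0 < p.-1%:R :> R by rewrite ltr0n; lia.
    rewrite addr_ge0 ?divr_ge0 ?exprn_ge0//=.
    have pE : p%:R = p.-1%:R + 1 :> R by rewrite -{1}(prednK (prime_gt0 pp)) -addn1 natrD.
    have pR : 0 < p%:R :> R by rewrite pE; lra.
    apply: le_trans (ler_wpM2r _ (expR_ge1Dx _)); last by rewrite invr_ge0 ltW ?primefactor_gt0.
    rewrite primefactorE ?prime_gt0// invf_div le_eqVlt; apply/orP; left; apply/eqP.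
    move: q0 pR; rewrite pE; move: (p.-1%:R) => x x0 x1.
    by field; apply/andP; split; rewrite gt_eqF.
  rewrite ler_wpM2r//; first by apply: prodr_ge0 => p /andP[pp _]; rewrite invr_ge0 ltW ?primefactor_gt0.
  rewrite ler_expR; apply: le_trans (sum_inv_consecutive R N).
  rewrite big_mkcondr/=; apply: ler_sum => p pp; by case: ifP.
have rhoQ : rho Q = \prod_(0 <= p < N | prime p && (p %| Q)%N) u p *
    \prod_(N <= p < M | prime p && (p %| Q)%N) u p.
  have NM : (N <= M)%N by rewrite leq_addr.
  rewrite (@phi_ratioE R Q M) ?Q0 ?leq_addl// -big_mkcondr/=.
  by rewrite [LHS](big_cat_nat _ NM).
have E3 : \prod_(0 <= p < N | prime p && D p) (u p)^-1 =
    \prod_(0 <= p < N | prime p) (u p)^-1 * rho Q *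
    \prod_(N <= p < M | prime p && (p %| Q)%N) (u p)^-1.
  have nz a b : \prod_(a <= p < b | prime p && (p %| Q)%N) u p != 0.
    by rewrite gt_eqF//; apply: prodr_gt0 => p /andP[pp _]; exact: primefactor_gt0.
  rewrite (bigID (fun p => p %| Q)%N prime)/= rhoQ !prodfV.
  have nc : \prod_(0 <= p < N | prime p && ~~ (p %| Q)%N) u p != 0.
    by rewrite gt_eqF//; apply: prodr_gt0 => p /andP[pp _]; exact: primefactor_gt0.
  move: (nz 0%N N) (nz N M) nc; rewrite /D.
  move: (\prod_(0 <= p < N | prime p && (p %| Q)%N) u p) (\prod_(N <= p < M | prime p && (p %| Q)%N) u p)
    (\prod_(0 <= p < N | prime p && ~~ (p %| Q)%N) u p) => a b d a0 b0 d0.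
  by field; rewrite a0 b0 d0.
have i0 : (0 < i)%N by rewrite /i addnS.
have rho0 := phi_ratio_ge0 R Q.
have E4 : \prod_(0 <= p < N | prime p && D p) (u p)^-1 <= expR 11 * i%:R * rho Q * expR 4.
  rewrite E3; apply: ler_pM.
  - by rewrite mulr_ge0//; apply: prodr_ge0 => p pp; rewrite invr_ge0 ltW ?primefactor_gt0.
  - by apply: prodr_ge0 => p /andP[pp _]; rewrite invr_ge0 ltW ?primefactor_gt0.
  - by rewrite ler_wpM2r//; exact: mertens_product.
  - by apply: (@prod_large_prime_divisors Q h i M Q0 Qh); rewrite /i leq_addr.
have E5 : \sum_(1 <= r < X.+1) f r / r%:R <= expR 16 * i%:R * rho Q.
  apply: le_trans E1 (le_trans E2 _).
  rewrite (_ : expR 16 * i%:R * rho Q = expR 1 * (expR 11 * i%:R * rho Q * expR 4)).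
    by rewrite ler_wpM2l ?expR_ge0.
  have -> : 16 = 1 + 11 + 4 :> R by lra.
  rewrite !expRD; ring.
have lnX : j.+1%:R / 2 <= 1 + ln X%:R :> R.
  have : ln (2 ^ j)%:R <= ln X%:R :> R.
    by rewrite ler_ln ?posrE ?ltr0n ?expn_gt0// ler_nat trunc_logP.
  rewrite natrX lnXn// -[X in X <= _]mulr_natl -[j.+1]addn1 natrD.
  have := ln2_ge_half R; have : 0 <= j%:R :> R by [].
  move: (j%:R) (ln 2) => a b; nra.
have S0 : 0 <= S by apply: sumr_ge0 => r _; rewrite invr_ge0 phi_ratio_ge0.
have J0 : 0 < j.+1%:R :> R by [].
have key : j.+1%:R / 2 * S <= 9 * X%:R * (expR 16 * i%:R * rho Q).
  apply: le_trans (ler_wpM2r S0 lnX) (le_trans HT _).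
  by rewrite ler_wpM2l// mulr_ge0// ltW.
have -> : 18 * expR 16 * X%:R * rho Q * (1 + h%:R / j.+1%:R) =
    9 * X%:R * (expR 16 * i%:R * rho Q) / (j.+1%:R / 2).
  by rewrite /i natrD; field; rewrite gt_eqF.
by rewrite ler_pdivlMr ?divr_gt0// mulrC.
Qed.

End SieveBound.

(** * Counting pairs of fractions at a given distance *)

Section PeriodicSums.
Variable R : realType.
Local Notation u := (@primefactor R).
Local Notation rho := (@phi_ratio R).

Lemma periodic_mul (T : Type) (F : nat -> T) q : (forall t, F (t + q)%N = F t) ->
  forall k t, F (t + k * q)%N = F t.
Proof.
move=> Fq; elim=> [|k IH] t; first by rewrite mul0n addn0.
by rewrite mulSn addnA IH.
Qed.

Lemma periodic_mod (T : Type) (F : nat -> T) q : (forall t, F (t + q)%N = F t) ->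
  forall t, F (t %% q)%N = F t.
Proof. by move=> Fq t; rewrite [in RHS](divn_eq t q) addnC (periodic_mul Fq). Qed.

Lemma sum_affine_periodic (G : nat -> R) p c x : (0 < p)%N -> coprime c p ->
  (forall t, G (t + p)%N = G t) ->
  \sum_(0 <= t < p) G (t * c + x)%N = \sum_(0 <= t < p) G t.
Proof.
move=> p0 cp Gp; rewrite !big_mkord.
pose h (t : 'I_p) : 'I_p := Ordinal (ltn_pmod (t * c + x) p0).
have key (a b : nat) : (b <= a)%N -> (a < p)%N -> a * c == b * c %[mod p] -> a = b.
  move=> ba ap; rewrite eqn_mod_dvd ?leq_mul2r ?ba ?orbT// -mulnBl.
  rewrite Gauss_dvdl ?(coprime_sym p)// => pab; apply/eqP; rewrite eqn_leq ba andbT.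
  rewrite -subn_eq0 -leqn0 leqNgt; apply/negP => ab0.
  have := dvdn_leq ab0 pab; rewrite leqNgt => /negP; apply.
  by apply: leq_ltn_trans ap; rewrite leq_subr.
have hinj : injective h.
  move=> s t /(congr1 val)/= /eqP; rewrite eqn_modDr => st; apply/val_inj => /=.
  case: (leqP t s) => ts; first exact: key.
  apply: esym; apply: (key t s (ltnW ts) (ltn_ord t)); rewrite eq_sym; exact: st.
rewrite [RHS](reindex_inj hinj)/=; apply: eq_bigr => t _.
by rewrite (periodic_mod Gp).
Qed.

Lemma sum_nat_mul (F : nat -> R) q k :
  \sum_(0 <= t < k * q) F t = \sum_(0 <= j < k) \sum_(0 <= i < q) F (i + j * q)%N.
Proof.
elim: k => [|k IH]; first by rewrite mul0n !big_geq.
rewrite [RHS]big_nat_recr//= -IH mulSnr.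
rewrite (@big_cat_nat _ _ _ (k * q))//= ?leq_addr//; congr (_ + _).
by rewrite -{1}[(k * q)%N]add0n big_addn addKn.
Qed.

Lemma sum_periodic_mul (F : nat -> R) q k : (forall t, F (t + q)%N = F t) ->
  \sum_(0 <= t < k * q) F t = k%:R * \sum_(0 <= t < q) F t.
Proof.
move=> Fq; rewrite sum_nat_mul.
under eq_bigr do under eq_bigr do rewrite (periodic_mul Fq).
by rewrite big_const_nat subn0 iter_addr_0 mulr_natl.
Qed.

(** The Chinese remainder theorem: with [t = i + j q] and [i] fixed, [t] runs through all residues
    modulo [p] as [j] does. *)
Lemma sum_periodic_coprime (F G : nat -> R) p q : (0 < p)%N -> (0 < q)%N -> coprime q p ->
  (forall t, F (t + q)%N = F t) -> (forall t, G (t + p)%N = G t) ->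
  \sum_(0 <= t < p * q) G t * F t =
  (\sum_(0 <= t < p) G t) * \sum_(0 <= t < q) F t.
Proof.
move=> p0 q0 qp Fq Gp; rewrite sum_nat_mul exchange_big/= mulr_sumr.
apply: eq_bigr => i _; rewrite -(@sum_affine_periodic G p q i p0 qp Gp) mulr_suml.
by apply: eq_bigr => j _; rewrite (periodic_mul Fq) addnC.
Qed.

Lemma sum_prod_periodic (G : nat -> nat -> R) s : all prime s -> uniq s ->
  (forall p, p \in s -> forall t, G p (t + p)%N = G p t) ->
  \sum_(0 <= t < \prod_(p <- s) p) \prod_(p <- s) G p t =
  \prod_(p <- s) \sum_(0 <= t < p) G p t.
Proof.
elim: s => [|p s IH]/=; first by rewrite !big_nil big_nat1 big_nil.
move=> /andP[pp sp] /andP[ps us] hG; rewrite !big_cons.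
have hGs q : q \in s -> forall t, G q (t + q)%N = G q t.
  by move=> qs; apply: hG; rewrite inE qs orbT.
rewrite -IH//; under eq_bigr do rewrite big_cons.
have s0 : (0 < \prod_(p <- s) p)%N.
  by rewrite big_seq; apply: prodn_cond_gt0 => q qs; rewrite prime_gt0// (allP sp).
rewrite sum_periodic_coprime//; first exact: prime_gt0.
- rewrite big_seq; apply: (big_ind (fun n => coprime n p)) => [|m n|q qs].
  + by rewrite coprime1n.
  + by rewrite coprimeMl => -> ->.
  + rewrite prime_coprime ?dvdn_prime2 ?(allP sp q qs)//.
    by apply: contraNneq ps => <-.
- move=> t; rewrite big_seq [RHS]big_seq; apply: eq_bigr => q qs.
  rewrite (big_rem q qs)/= mulnC; apply: periodic_mul; exact: hGs.
- by apply: hG; rewrite inE eqxx.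
Qed.

(** The summand has the radical of [g] as a period, so the Chinese remainder theorem is applied to
    the radical and the period is repeated; hence the normalised factors. *)
Lemma sum_prod_primes (G : nat -> nat -> R) g : (0 < g)%N ->
  (forall p, p \in primes g -> forall t, G p (t + p)%N = G p t) ->
  \sum_(0 <= t < g) \prod_(p <- primes g) G p t =
  g%:R * \prod_(p <- primes g) ((\sum_(0 <= t < p) G p t) / p%:R).
Proof.
move=> g0 hG; set q := (\prod_(p <- primes g) p)%N.
have qg : (q %| g)%N.
  rewrite [X in (_ %| X)%N](prod_prime_decomp g0) prime_decompE big_map/= /q.
  rewrite big_seq [X in (_ %| X)%N]big_seq.
  apply: (big_ind2 (fun a b => a %| b)%N) => // [a b c d|p pg]; first exact: dvdn_mul.
  by apply: dvdn_exp => //; rewrite logn_gt0.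
have q0 : (0 < q)%N by apply: dvdn_gt0 qg.
rewrite -{1}(divnK qg) sum_periodic_mul; last first.
  move=> t; rewrite big_seq [RHS]big_seq; apply: eq_bigr => p ps.
  rewrite /q (big_rem p ps)/= mulnC; apply: periodic_mul; exact: hG.
rewrite sum_prod_periodic ?all_prime_primes ?primes_uniq//.
have gE : g%:R = (g %/ q)%:R * q%:R :> R by rewrite -natrM divnK.
rewrite prodf_div -natr_prod -/q gE -mulrA; congr (_ * _).
by rewrite mulrCA divff ?mulr1// pnatr_eq0 -lt0n.
Qed.

(* The sum over [t] counts the residues avoiding the zeros of the two affine forms modulo [p];
   the zeros are distinct unless [p] divides one of the slopes or the determinant [r]. *)
Lemma sum_ndvdn_le p x y m n r : prime p -> (0 < r)%N -> coprime m n -> (x * n = y * m + r)%N ->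
  (\sum_(0 <= t < p) (~~ (p %| x + t * m)%N)%:R * (~~ (p %| y + t * n)%N)%:R) / p%:R <=
  (if (p %| m * n)%N then u p else if (p %| r)%N then u p else u p ^+ 2) :> R.
Proof.
move=> pp r0 mn xy; have p0 := prime_gt0 pp; have pR : 0 < p%:R :> R by rewrite ltr0n.
have sum1 c z : ~~ (p %| c)%N -> \sum_(0 <= t < p) (p %| z + t * c)%N%:R = 1 :> R.
  move=> pc; under eq_bigr do rewrite addnC.
  rewrite (@sum_affine_periodic (fun t => (p %| t)%N%:R) p c z p0).
  - case: (p) p0 => // p' _; rewrite big_nat_recl// dvdn0 big1_seq ?addr0//.
    by move=> i; rewrite mem_index_iota => /andP[_ ip]; rewrite gtnNdvd.
  - by rewrite coprime_sym prime_coprime.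
  - by move=> t; rewrite dvdn_addl ?dvdnn.
have sumn c z : ~~ (p %| c)%N -> \sum_(0 <= t < p) (~~ (p %| z + t * c)%N)%:R = p%:R - 1 :> R.
  move=> pc; rewrite -[X in _ = _ - X](sum1 c z pc).
  have <- : \sum_(0 <= t < p) 1 = p%:R :> R by rewrite sumr_const_nat subn0.
  by rewrite -sumrB; apply: eq_bigr => t _; case: (p %| _)%N; rewrite /= ?subrr ?subr0.
have S1 : \sum_(0 <= t < p) (~~ (p %| x + t * m)%N)%:R * (~~ (p %| y + t * n)%N)%:R <= p%:R - 1 :> R.
  case: (boolP (p %| m)%N) => pm; last first.
    rewrite -(sumn m x pm); apply: ler_sum => t _.
    by case: (p %| x + t * m)%N; case: (p %| y + t * n)%N; rewrite /= ?mulr0 ?mul0r ?mulr1 ?ler01 ?lexx.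
  have pn : ~~ (p %| n)%N.
    apply/negP => pn; have : (p %| gcdn m n)%N by rewrite dvdn_gcd pm.
    by rewrite (eqP mn) dvdn1 => /eqP p1; rewrite p1 in pp.
  rewrite -(sumn n y pn); apply: ler_sum => t _.
  by case: (p %| x + t * m)%N; case: (p %| y + t * n)%N; rewrite /= ?mulr0 ?mul0r ?mulr1 ?ler01 ?lexx.
have uE : u p = (p%:R - 1) / p%:R by rewrite /primefactor mulrBl divff ?gt_eqF// div1r.
have le1 : (\sum_(0 <= t < p) (~~ (p %| x + t * m)%N)%:R * (~~ (p %| y + t * n)%N)%:R) / p%:R <= u p :> R.
  by rewrite uE ler_pM2r ?invr_gt0.
case: ifP => // pmn; case: ifP => // pr.
have [pm pn] : ~~ (p %| m)%N /\ ~~ (p %| n)%N.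
  by move: pmn; rewrite Euclid_dvdM// => /negbT; rewrite negb_or => /andP.
(* [p] never divides both forms, because [(x + t m) n - (y + t n) m = r]. The sum is therefore
   [p - 2], and [(p - 2) p <= (p - 1)^2]. *)
have -> : \sum_(0 <= t < p) (~~ (p %| x + t * m)%N)%:R * (~~ (p %| y + t * n)%N)%:R =
   \sum_(0 <= t < p) ((~~ (p %| x + t * m)%N)%:R - (p %| y + t * n)%N%:R) :> R.
  apply: eq_bigr => t _; case: (boolP (p %| x + t * m)%N) => px; case: (boolP (p %| y + t * n)%N) => py; rewrite /= ?mulr0 ?mulr1 ?subr0 ?subrr//.
  have : (p %| (x + t * m) * n - (y + t * n) * m)%N by rewrite dvdn_sub ?dvdn_mulr.
  rewrite !mulnDl xy (_ : _ - _ = r)%N ?pr//.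
  by rewrite -addnA [(r + _)%N]addnC addnA mulnAC [(t * n * m)%N]mulnAC addnC addnK.
rewrite sumrB sumn// sum1// uE.
rewrite -(ler_pM2r (_ : 0 < p%:R ^+ 2)) ?exprn_gt0//.
have -> : (p%:R - 1 - 1) / p%:R * p%:R ^+ 2 = (p%:R - 1 - 1) * p%:R :> R by field; rewrite gt_eqF.
have -> : ((p%:R - 1) / p%:R) ^+ 2 * p%:R ^+ 2 = (p%:R - 1) ^+ 2 :> R by field; rewrite gt_eqF.
by move: (p%:R) => z; rewrite expr2; lra.
Qed.

Lemma coprime_prod_primes x g : (0 < g)%N ->
  (coprime x g)%:R = \prod_(p <- primes g) (~~ (p %| x)%N)%:R :> R.
Proof.
move=> g0; case: (boolP (coprime x g)) => xg.
  rewrite big_seq big1// => p; rewrite mem_primes => /and3P[pp _ pg].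
  rewrite (_ : (p %| x)%N = false)//; apply/negbTE/negP => px.
  have : (p %| gcdn x g)%N by rewrite dvdn_gcd px.
  by rewrite (eqP xg) dvdn1 => /eqP p1; rewrite p1 in pp.
have d1 : (1 < gcdn x g)%N.
  by move: xg; rewrite /coprime; case: (gcdn x g) (gcdn_gt0 x g) => [|[|]]//; rewrite g0 orbT.
have pd := pdiv_prime d1; have := pdiv_dvd (gcdn x g); rewrite dvdn_gcd => /andP[px pg].
rewrite (big_rem (pdiv (gcdn x g)))/= ?px ?mul0r//.
by rewrite mem_primes pd g0.
Qed.

(** Pairs of reduced fractions with [a / m - b / n = r / lcm(m, n)]. The equation is kept free of
    subtraction; negative differences are reached by exchanging [m] and [n]. *)
Definition pair_count m n r : nat :=
  (\sum_(1 <= a < m.+1) \sum_(1 <= b < n.+1)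
    [&& coprime a m, coprime b n & a * n == b * m + gcdn m n * r])%N.

(** After division by the gcd [g], the solutions are [(x + t m', y + t n')] with [(x, y)] the least
    one, and [a <= m] forces [t < g]. Of the coprimality conditions only those with [g] are kept,
    and they are tested one prime of [g] at a time. *)
Lemma pair_count_le m n r : (0 < m)%N -> (0 < n)%N -> (0 < r)%N ->
  (pair_count m n r)%:R <= (gcdn m n)%:R *
    \prod_(p <- primes (gcdn m n))
      (if (p %| (m %/ gcdn m n) * (n %/ gcdn m n))%N then u p
       else if (p %| r)%N then u p else u p ^+ 2) :> R.
Proof.
move=> m0 n0 r0; set g := gcdn m n; set m' := (m %/ g)%N; set n' := (n %/ g)%N.
have g0 : (0 < g)%N by rewrite gcdn_gt0 m0.
have mE : m = (m' * g)%N by rewrite divnK// dvdn_gcdl.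
have nE : n = (n' * g)%N by rewrite divnK// dvdn_gcdr.
have m'0 : (0 < m')%N by move: m0; rewrite {1}mE muln_gt0 => /andP[].
have n'0 : (0 < n')%N by move: n0; rewrite {1}nE muln_gt0 => /andP[].
have mn' : coprime m' n'.
  by rewrite /coprime -(eqn_pmul2r g0) muln_gcdl -mE -nE mul1n.
have eqE a b : (a * n == b * m + g * r)%N = (a * n' == b * m' + r)%N.
  by rewrite {1}mE {1}nE !mulnA [(g * r)%N]mulnC -mulnDl eqn_pmul2r.
pose P a := [exists b : 'I_(a * n').+1, a * n' == b * m' + r]%N.
have PE a b : (a * n' = b * m' + r)%N -> P a.
  move=> e; have bl : (b < (a * n').+1)%N by rewrite ltnS e; nia.
  by apply/existsP; exists (Ordinal bl); rewrite /= e.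
case: (pselect (exists a, P a)) => [exP|noP]; last first.
  rewrite /pair_count big1 ?mulr_ge0//.
    rewrite big_seq; apply: prodr_ge0 => p; rewrite mem_primes => /and3P[pp _ _].
    have u0 := ltW (primefactor_gt0 R pp).
    by case: ifP => _; [|case: ifP => _]; rewrite ?exprn_ge0.
  move=> a _; rewrite big1// => b _; apply/eqP; rewrite eqb0.
  by apply/negP => /and3P[_ _]; rewrite eqE => /eqP /PE Pa; apply: noP; exists a.
have [x Px xmin] := ex_minnP exP.
have [[y /= _] /eqP xy] := existsP Px.
have sol a b : (a * n' = b * m' + r)%N -> exists t, a = (x + t * m')%N /\ b = (y + t * n')%N.
  move=> ab; have xa := xmin a (PE _ _ ab).
  have yb : (y <= b)%N.
    rewrite -(leq_pmul2r m'0) -(leq_add2r r) -xy -ab leq_mul2r xa orbT//.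
  have e : ((a - x) * n' = (b - y) * m')%N by rewrite !mulnBl ab xy; lia.
  have : (m' %| (a - x) * n')%N by rewrite e dvdn_mull.
  rewrite Gauss_dvdl// => /dvdnP[t at_]; exists t; split; first by rewrite -at_ subnKC.
  move: e; rewrite at_ mulnAC => /eqP; rewrite eqn_pmul2r// => /eqP ->; rewrite subnKC//.
(* Positivity of [x] is what excludes [t = g], since [x + t m' <= g m']. *)
have x0 : (0 < x)%N by case: (x) xy => //; rewrite mul0n; lia.
pose G p t : R := (~~ (p %| x + t * m')%N)%:R * (~~ (p %| y + t * n')%N)%:R.
have le1 : (pair_count m n r)%:R <= \sum_(0 <= t < g) \prod_(p <- primes g) G p t.
  have GE t : \prod_(p <- primes g) G p t = (coprime (x + t * m') g && coprime (y + t * n') g)%:R.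
    by rewrite /G big_split/= -!coprime_prod_primes// -natrM mulnb.
  under [leRHS]eq_bigr do rewrite GE.
  rewrite -natr_sum ler_nat /pair_count.
  apply: (@leq_trans (\sum_(1 <= a < m.+1) \sum_(1 <= b < n.+1) \sum_(0 <= t < g)
     ((a == x + t * m') * (b == y + t * n') * (coprime (x + t * m') g && coprime (y + t * n') g)))%N).
    rewrite big_nat_cond [X in (_ <= X)%N]big_nat_cond.
    apply: leq_sum => a /andP[/andP[a1 am] _]; apply: leq_sum => b _.
    case: (boolP [&& _, _ & _]) => // /and3P[ca cb].
    rewrite eqE => /eqP /sol [t [at_ bt]].
    have tg : (t < g)%N.
      rewrite -(ltn_pmul2r m'0) [(g * m')%N]mulnC -mE -ltnS; apply: leq_trans am; rewrite at_ ltnS; lia.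
    rewrite (bigD1_seq t) ?iota_uniq ?mem_index_iota//= -at_ -bt !eqxx.
    by rewrite (coprime_dvdr (dvdn_gcdl m n) ca) (coprime_dvdr (dvdn_gcdr m n) cb).
  under eq_bigr do rewrite exchange_big/=.
  rewrite exchange_big/=; apply: leq_sum => t _.
  have sum_eq1 M A : (\sum_(1 <= i < M) (i == A) <= 1)%N.
    have -> : (\sum_(1 <= i < M) (i == A) = \sum_(1 <= i < M | i == A) 1)%N.
      by rewrite [RHS]big_mkcond; apply: eq_bigr => i _; case: eqP.
    by rewrite big_nat1_eq; case: ifP.
  move: (coprime _ _ && coprime _ _) => c.
  have -> : (\sum_(1 <= a < m.+1) \sum_(1 <= b < n.+1)
      (a == x + t * m') * (b == y + t * n') * c =
     (\sum_(1 <= a < m.+1) (a == x + t * m')) * (\sum_(1 <= b < n.+1) (b == y + t * n')) * c)%N.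
    rewrite big_distrl/= big_distrl/=; apply: eq_bigr => a _.
    by rewrite big_distrr/= big_distrl.
  by rewrite -[X in (_ <= X)%N]mul1n leq_mul// -[X in (_ <= X)%N]mul1n leq_mul.
apply: le_trans le1 _; rewrite sum_prod_primes//; last first.
  move=> p _ t; have per z c : (p %| z + (t + p) * c)%N = (p %| z + t * c)%N.
    by rewrite mulnDl addnA dvdn_addl// dvdn_mulr.
  by rewrite /G !per.
rewrite ler_wpM2l// big_seq [leRHS]big_seq; apply: ler_prod => p pg.
have pp : prime p by move: pg; rewrite mem_primes => /andP[].
rewrite sum_ndvdn_le// divr_ge0// sumr_ge0// => t _; rewrite /G mulr_ge0//.
Qed.

(** A prime dividing [r] and [m / g] divides [a * (n / g)], hence [a] or [n / g]; either contradicts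
    a coprimality. The case of [n / g] is symmetric. *)
Lemma pair_count_eq0 m n r : (0 < m)%N -> (0 < n)%N -> (0 < r)%N ->
  ~~ coprime r ((m %/ gcdn m n) * (n %/ gcdn m n)) -> pair_count m n r = 0%N.
Proof.
move=> m0 n0 r0; set g := gcdn m n; set m' := (m %/ g)%N; set n' := (n %/ g)%N.
have g0 : (0 < g)%N by rewrite gcdn_gt0 m0.
have mE : m = (m' * g)%N by rewrite divnK// dvdn_gcdl.
have nE : n = (n' * g)%N by rewrite divnK// dvdn_gcdr.
have mn' : coprime m' n'.
  by rewrite /coprime -(eqn_pmul2r g0) muln_gcdl -mE -nE mul1n.
move=> ncop; rewrite /pair_count big1// => a _; rewrite big1// => b _.
apply/eqP; rewrite eqb0; apply/negP => /and3P[ca cb].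
rewrite -/g {1}mE {1}nE !mulnA [(g * r)%N]mulnC -mulnDl eqn_pmul2r// => /eqP e.
have nocommon x y p : coprime x y -> prime p -> (p %| x)%N -> (p %| y)%N -> False.
  move=> xy pp px py; have : (p %| gcdn x y)%N by rewrite dvdn_gcd px.
  by rewrite (eqP xy) dvdn1 => /eqP p1; rewrite p1 in pp.
have d1 : (1 < gcdn r (m' * n'))%N.
  by move: ncop; rewrite /coprime; case: (gcdn _ _) (gcdn_gt0 r (m' * n')) => [|[|]]//; rewrite r0.
have pp := pdiv_prime d1; have := pdiv_dvd (gcdn r (m' * n')); rewrite dvdn_gcd.
set p := pdiv _ in pp *; move=> /andP[pr]; rewrite Euclid_dvdM// => /orP[pm|pn].
  have : (p %| a * n')%N by rewrite e dvdn_add// dvdn_mull.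
  rewrite Euclid_dvdM// => /orP[pa|pn]; last exact: nocommon mn' pp pm pn.
  by apply: nocommon ca pp pa _; rewrite mE dvdn_mulr.
have : (p %| b * m')%N by rewrite -(dvdn_addl _ pr) -e dvdn_mull.
rewrite Euclid_dvdM// => /orP[pb|pm]; last exact: nocommon mn' pp pm pn.
by apply: nocommon cb pp pb _; rewrite nE dvdn_mulr.
Qed.

Lemma prod_primes_nat (F : nat -> R) g M : (0 < g < M)%N ->
  \prod_(p <- primes g) F p = \prod_(0 <= p < M | prime p) (if (p %| g)%N then F p else 1).
Proof.
move=> /andP[g0 gM]; rewrite -big_mkcondr /= -[RHS]big_filter.
congr (\big[_/_]_(_ <- _) _).
rewrite -(filter_pi_of gM); apply: eq_in_filter => p _.
by rewrite [LHS](mem_primes p g) g0.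
Qed.

(** The local factors of [pair_count_le] that are free of [r] form [W], with
    [W * rho Q = rho m * rho n] for [Q = m' * n']. Primes dividing [r] lose one factor [1 - 1/p], in
    total at most [1 / rho r]; so the sum over [r] coprime to [Q] is the one bounded by
    [coprime_sieve], which returns the missing [rho Q]. *)
Lemma pair_count_sum m n h X : (0 < m)%N -> (0 < n)%N ->
  (m < 2 ^ (2 ^ h.+1))%N -> (n < 2 ^ (2 ^ h.+1))%N -> (0 < X)%N ->
  \sum_(1 <= r < X.+1) (pair_count m n r)%:R <=
    18 * expR 16 * ((gcdn m n)%:R * X%:R) * (rho m * rho n) *
      (1 + h%:R / (trunc_log 2 X).+1%:R) :> R.
Proof.
move=> m0 n0 mh nh X0; set g := gcdn m n; set m' := (m %/ g)%N; set n' := (n %/ g)%N.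
have g0 : (0 < g)%N by rewrite gcdn_gt0 m0.
have mE : m = (m' * g)%N by rewrite divnK// dvdn_gcdl.
have nE : n = (n' * g)%N by rewrite divnK// dvdn_gcdr.
have m'0 : (0 < m')%N by move: m0; rewrite {1}mE muln_gt0 => /andP[].
have n'0 : (0 < n')%N by move: n0; rewrite {1}nE muln_gt0 => /andP[].
have mn' : coprime m' n'.
  by rewrite /coprime -(eqn_pmul2r g0) muln_gcdl -mE -nE mul1n.
set Q := (m' * n')%N; have Q0 : (0 < Q)%N by rewrite muln_gt0 m'0.
have Qh : (Q < 2 ^ (2 ^ h.+2))%N.
  rewrite [(2 ^ h.+2)%N]expnS mul2n -addnn expnD; apply: ltn_mul.
    by apply: leq_ltn_trans mh; rewrite leq_div.
  by apply: leq_ltn_trans nh; rewrite leq_div.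
pose W : R := \prod_(p <- primes g) (if (p %| Q)%N then u p else u p ^+ 2).
have gm : (g <= m)%N by rewrite mE leq_pmull.
have WQ : W * rho Q = rho m * rho n.
  pose M := (m + n + Q).+1.
  have [mM nM QM gM] : [/\ (0 < m < M)%N, (0 < n < M)%N, (0 < Q < M)%N & (0 < g < M)%N].
    by rewrite /M m0 n0 Q0 g0; split; lia.
  rewrite /W (prod_primes_nat _ gM) (phi_ratioE R QM) (phi_ratioE R mM) (phi_ratioE R nM).
  rewrite -!big_split/=; apply: eq_bigr => p pp.
  rewrite {1}mE {1}nE /Q !Euclid_dvdM//.
  case: (boolP (p %| g)%N) => pg; case: (boolP (p %| m')%N) => pm; case: (boolP (p %| n')%N) => pn;
    rewrite /= ?mulr1 ?mul1r//.
  have : (p %| gcdn m' n')%N by rewrite dvdn_gcd pm.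
  by rewrite (eqP mn') dvdn1 => /eqP p1; rewrite p1 in pp.
have W0 : 0 <= W.
  rewrite /W big_seq; apply: prodr_ge0 => p; rewrite mem_primes => /andP[pp _].
  have u0 := ltW (primefactor_gt0 R pp); by case: ifP => _; rewrite ?exprn_ge0.
have le1 : \sum_(1 <= r < X.+1) (pair_count m n r)%:R <=
    g%:R * W * \sum_(1 <= r < X.+1 | coprime r Q) (rho r)^-1.
  rewrite mulr_sumr [leRHS]big_mkcond; apply: ler_sum_nat => r /andP[r0 _].
  case: ifP => [crQ|/negbT ncrQ]; last by rewrite pair_count_eq0.
  apply: le_trans (pair_count_le m0 n0 r0) _; rewrite -mulrA ler_wpM2l//.
  rewrite ler_pdivlMr ?phi_ratio_gt0//.
  have [gM rM] : (0 < g < (g + r).+1)%N /\ (0 < r < (g + r).+1)%N by rewrite g0 r0; lia.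
  rewrite /W !(prod_primes_nat _ gM) (phi_ratioE R rM) -big_split/=.
  apply: ler_prod => p pp; have u0 := ltW (primefactor_gt0 R pp).
  have u1 := primefactor_le1 R p.
  rewrite -/Q; case: (p %| g)%N; case: (p %| Q)%N; case: (p %| r)%N; rewrite ?mulr1 ?mul1r ?lexx ?mulr_ge0 ?exprn_ge0 ?u0 ?u1 ?ler01//=.
  by rewrite ler_piMr.
apply: le_trans le1 _.
have h1 := coprime_sieve R Q0 Qh X0.
have gW0 : 0 <= g%:R * W by rewrite mulr_ge0.
apply: le_trans (ler_wpM2l gW0 h1) _.
by rewrite -WQ le_eqVlt; apply/orP; left; apply/eqP; ring.
Qed.

End PeriodicSums.

(** * Overlaps averaged over scales *)

Section Overlap.
Variable R : realType.
Local Notation rho := (@phi_ratio R).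

(* Bounds the measure of the overlap of the intervals of radius [x / m] and [y / n] around the
   reduced fractions of denominators [m] and [n], coinciding centres excluded. *)
Definition overlap_bound (m n : nat) (x y : R) : R :=
  \sum_(1 <= a < m.+1 | coprime a m) \sum_(1 <= b < n.+1 | coprime b n)
    (if (a * n != b * m)%N && (`|a%:R * n%:R - b%:R * m%:R| < x * n%:R + y * m%:R)
     then 2 * Num.min (x / m%:R) (y / n%:R) else 0).

(** With [s = x / m] and [t = y / n], this is [min(s, t) (s + t) <= 2 s t] multiplied by [m n]. *)
Lemma min_mul_le (m n : nat) (x y z : R) : (0 < m)%N -> (0 < n)%N -> 0 <= x -> 0 <= y ->
  0 <= z -> z <= x * n%:R + y * m%:R ->
  Num.min (x / m%:R) (y / n%:R) * z <= 2 * (x * y).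
Proof.
move=> m0 n0 x0 y0 z0 zle.
have mR : 0 < m%:R :> R by rewrite ltr0n.
have nR : 0 < n%:R :> R by rewrite ltr0n.
have xm : 0 <= x / m%:R by rewrite divr_ge0.
have yn : 0 <= y / n%:R by rewrite divr_ge0.
have -> : 2 * (x * y) = 2 * (x / m%:R * (y / n%:R)) * (m%:R * n%:R).
  by field; rewrite !gt_eqF.
have zle' : z <= (x / m%:R + y / n%:R) * (m%:R * n%:R).
  apply: le_trans zle _; rewrite le_eqVlt; apply/orP; left; apply/eqP.
  by field; rewrite !gt_eqF.
have mn : 0 < m%:R * n%:R :> R by rewrite mulr_gt0.
move: (x / _) (y / _) (m%:R * n%:R) xm yn mn zle' => s t w s0 t0 w0 zle'.
have min0 : 0 <= Num.min s t by rewrite le_min s0.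
apply: le_trans (ler_wpM2l min0 zle') _.
rewrite [leLHS]mulrA ler_pM2r//.
have h1 : Num.min s t <= s by rewrite ge_min lexx.
have h2 : Num.min s t <= t by rewrite ge_min lexx orbT.
nra.
Qed.

(** Distinct centres have [a n - b m = r g] or [- r g] with [1 <= r <= X]. The constant is 18 times
    2 for the two signs, 2 for the length [2 min], and 2 from [min_mul_le]. *)
Lemma overlap_bound_le m n h (x y : R) X : (0 < m)%N -> (0 < n)%N ->
  (m < 2 ^ (2 ^ h.+1))%N -> (n < 2 ^ (2 ^ h.+1))%N -> 0 <= x -> 0 <= y ->
  (forall r : nat, (r * gcdn m n)%N%:R < x * n%:R + y * m%:R -> (r <= X)%N) ->
  (X * gcdn m n)%N%:R <= x * n%:R + y * m%:R ->
  overlap_bound m n x y <= if (0 < X)%N then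
    144 * expR 16 * ((rho m * x) * (rho n * y)) * (1 + h%:R / (trunc_log 2 X).+1%:R) else 0.
Proof.
move=> m0 n0 mh nh x0 y0 hX Xz; set g := gcdn m n.
have g0 : (0 < g)%N by rewrite gcdn_gt0 m0.
pose mn := Num.min (x / m%:R) (y / n%:R).
have mn0 : 0 <= mn by rewrite le_min !divr_ge0.
have count_le : overlap_bound m n x y <=
    2 * mn * (\sum_(1 <= r < X.+1) ((pair_count m n r)%:R + (pair_count n m r)%:R)).
  pose c a b r : nat := [&& coprime a m, coprime b n & a * n == b * m + g * r]%N.
  pose d a b r : nat := [&& coprime a m, coprime b n & b * m == a * n + g * r]%N.
  have cE r : pair_count m n r = (\sum_(1 <= a < m.+1) \sum_(1 <= b < n.+1) c a b r)%N by [].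
  have dE r : pair_count n m r = (\sum_(1 <= a < m.+1) \sum_(1 <= b < n.+1) d a b r)%N.
    rewrite /pair_count exchange_big/=; apply: eq_bigr => a _; apply: eq_bigr => b _.
    by rewrite gcdnC /d andbCA.
  have -> : \sum_(1 <= r < X.+1) ((pair_count m n r)%:R + (pair_count n m r)%:R) =
     \sum_(1 <= a < m.+1) \sum_(1 <= b < n.+1) (\sum_(1 <= r < X.+1) (c a b r + d a b r))%N%:R :> R.
    under eq_bigr do rewrite -natrD cE dE -big_split/=.
    rewrite -natr_sum exchange_big/= natr_sum; apply: eq_bigr => a _.
    rewrite -natr_sum; congr (_%:R).
    under eq_bigr do rewrite -big_split/=.
    by rewrite exchange_big.
  rewrite /overlap_bound mulr_sumr big_mkcond/=.
  apply: ler_sum_nat => a /andP[a1 am]; case: ifP => ca; last first.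
    by rewrite mulr_ge0 ?mulr_ge0// sumr_ge0.
  rewrite mulr_sumr big_mkcond/=; apply: ler_sum_nat => b /andP[b1 bn].
  have rhs0 : 0 <= 2 * mn * (\sum_(1 <= r < X.+1) (c a b r + d a b r))%N%:R.
    by rewrite !mulr_ge0.
  case: ifP => cb //; case: ifP => // /andP[ne lt].
  rewrite -[leLHS]mulr1 ler_wpM2l ?mulr_ge0// -[1]/(1%:R) ler_nat.
  have gm : (g %| b * m)%N by rewrite dvdn_mull// dvdn_gcdl.
  have gn : (g %| a * n)%N by rewrite dvdn_mull// dvdn_gcdr.
  move: ne; rewrite neq_ltn => /orP[ltab|ltab].
    pose r := ((b * m - a * n) %/ g)%N.
    have rE : (r * g = b * m - a * n)%N by rewrite divnK// dvdn_sub.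
    have bm : (b * m = a * n + g * r)%N by rewrite [(g * r)%N]mulnC rE subnKC// ltnW.
    have r1 : (0 < r)%N by rewrite lt0n; apply/eqP => r0; move: bm ltab; rewrite r0; lia.
    have rX : (r <= X)%N.
      apply: hX; rewrite rE natrB ?(ltnW ltab)// !natrM.
      by apply: le_lt_trans lt; rewrite distrC ler_norm.
    rewrite (bigD1_seq r) ?iota_uniq ?mem_index_iota ?r1//= /d ca cb bm eqxx/=.
    by rewrite addn1.
  pose r := ((a * n - b * m) %/ g)%N.
  have rE : (r * g = a * n - b * m)%N by rewrite divnK// dvdn_sub.
  have bm : (a * n = b * m + g * r)%N by rewrite [(g * r)%N]mulnC rE subnKC// ltnW.
  have r1 : (0 < r)%N by rewrite lt0n; apply/eqP => r0; move: bm ltab; rewrite r0; lia.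
  have rX : (r <= X)%N.
    apply: hX; rewrite rE natrB ?(ltnW ltab)// !natrM.
    by apply: le_lt_trans lt; rewrite ler_norm.
  by rewrite (bigD1_seq r) ?iota_uniq ?mem_index_iota ?r1//= /c ca cb bm eqxx/=.
apply: le_trans count_le _; case: posnP => [->|X0]; first by rewrite big_geq// mulr0.
have h1 := pair_count_sum R m0 n0 mh nh X0.
have h2 := pair_count_sum R n0 m0 nh mh X0.
rewrite gcdnC [rho n * rho m]mulrC in h2; rewrite big_split/=.
set E := 1 + _ in h1 h2 *.
have E0 : 0 <= E by rewrite addr_ge0// divr_ge0.
have key := min_mul_le m0 n0 x0 y0 (ler0n _ _) Xz; rewrite -/mn natrM in key.
have cc : 0 <= 72 * expR 16 * (rho m * rho n) * E.
  by rewrite !mulr_ge0 ?expR_ge0 ?phi_ratio_ge0.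
have -> : 144 * expR 16 * (rho m * x * (rho n * y)) * E =
    72 * expR 16 * (rho m * rho n) * E * (2 * (x * y)) by ring.
apply: le_trans (ler_wpM2l cc key).
have -> : 72 * expR 16 * (rho m * rho n) * E * (mn * (X%:R * g%:R)) =
    2 * mn * (18 * expR 16 * (g%:R * X%:R) * (rho m * rho n) * E +
      18 * expR 16 * (g%:R * X%:R) * (rho m * rho n) * E) by ring.
by rewrite ler_wpM2l ?mulr_ge0// lerD.
Qed.

Lemma trunc_log_divn_expn N k : (2 ^ k <= N)%N ->
  trunc_log 2 (N %/ 2 ^ k) = (trunc_log 2 N - k)%N.
Proof.
move=> kN; have N0 : (0 < N)%N by apply: leq_trans kN; rewrite expn_gt0.
have k2 : (0 < 2 ^ k)%N by rewrite expn_gt0.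
have kl : (k <= trunc_log 2 N)%N by exact: trunc_log_max.
apply: trunc_log_eq => //; rewrite leq_divRL// ltn_divLR// -!expnD addSn subnK//.
by rewrite trunc_logP// trunc_log_ltn.
Qed.

Definition harmonic_sum (K : nat) : R := \sum_(1 <= j < K.+1) j%:R^-1.

Lemma harmonic_sumS K : harmonic_sum K.+1 = harmonic_sum K + K.+1%:R^-1.
Proof. by rewrite /harmonic_sum big_nat_recr. Qed.

Lemma harmonic_sum_rev K : \sum_(0 <= k < K) (K - k)%:R^-1 = harmonic_sum K.
Proof.
elim: K => [|K IH]; first by rewrite /harmonic_sum !big_geq.
rewrite harmonic_sumS -IH [LHS]big_nat_recl// subn0 addrC; congr (_ + _).
Qed.

Lemma harmonic_sum_homo : {homo harmonic_sum : m n / (m <= n)%N >-> m <= n}.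
Proof.
apply: homo_leq => [//|m n p|n]; first exact: le_trans.
by rewrite harmonic_sumS lerDl invr_ge0.
Qed.

Lemma sum_inv_truncated K J :
  \sum_(0 <= k < K | (k <= J)%N) (J - k).+1%:R^-1 <= harmonic_sum K.
Proof.
case: (leqP K J) => KJ.
  rewrite -harmonic_sum_rev big_mkcond; apply: ler_sum_nat => k /andP[_ kK].
  rewrite (leq_trans (ltnW kK))// lef_pV2 ?posrE ?ltr0n ?subn_gt0//.
  by rewrite ler_nat (leq_trans (leq_sub2r k KJ)).
apply: le_trans (harmonic_sum_homo KJ); rewrite -harmonic_sum_rev.
rewrite [leRHS](_ : _ = \sum_(0 <= k < K | (k <= J)%N) (J.+1 - k)%:R^-1).
  by apply: ler_sum => k kJ; rewrite subSn.
rewrite (big_nat_widen _ _ K)//.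
Qed.

(* Dividing both radii by [2^k] lowers the length of the sum over [r] from about [2^J] to
   [2^(J-k)], so the loss factors [1 + h / (J - k + 1)] average to [1 + h log K / K]. *)
Lemma overlap_scales m n h (x y : R) K : (0 < m)%N -> (0 < n)%N ->
  (m < 2 ^ (2 ^ h.+1))%N -> (n < 2 ^ (2 ^ h.+1))%N -> 0 <= x -> 0 <= y ->
  \sum_(0 <= k < K) (2 ^+ k) ^+ 2 * overlap_bound m n (x / 2 ^+ k) (y / 2 ^+ k) <=
    144 * expR 16 * ((rho m * x) * (rho n * y)) * (K%:R + h%:R * harmonic_sum K).
Proof.
move=> m0 n0 mh nh x0 y0; set g := gcdn m n.
have g0 : (0 < g)%N by rewrite gcdn_gt0 m0.
pose z := x * n%:R + y * m%:R.
have z0 : 0 <= z by rewrite addr_ge0// mulr_ge0.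
(* One cut-off serves all scales: at scale [k] it becomes [N %/ 2 ^ k], whose binary logarithm is
   exactly [J - k]. *)
have [N [hN Nz]] : exists N : nat, (forall r : nat, (r * g)%N%:R < z -> (r <= N)%N) /\ (N * g)%N%:R <= z.
  pose P r := (r * g)%N%:R <= z.
  have P0 : exists r, P r by exists 0%N; rewrite /P mul0n.
  have Pb r : P r -> (r <= Num.trunc z)%N.
    rewrite /P => rz; rewrite -ltnS -(ltr_nat R); apply: le_lt_trans (truncnS_gt z).
    by apply: le_trans rz; rewrite ler_nat leq_pmulr.
  have [N PN Nmax] := ex_maxnP P0 Pb.
  by exists N; split=> // r /ltW; exact: Nmax.
pose J := trunc_log 2 N.
have w0 : 0 <= 144 * expR 16 * ((rho m * x) * (rho n * y)).
  by rewrite !mulr_ge0 ?expR_ge0 ?phi_ratio_ge0.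
have term k : (2 ^+ k) ^+ 2 * overlap_bound m n (x / 2 ^+ k) (y / 2 ^+ k) <=
    144 * expR 16 * ((rho m * x) * (rho n * y)) *
    (1 + if (k <= J)%N then h%:R / (J - k).+1%:R else 0).
  have p2 : 0 < 2 ^+ k :> R by rewrite exprn_gt0.
  have zk : x / 2 ^+ k * n%:R + y / 2 ^+ k * m%:R = z / 2 ^+ k by rewrite /z; field; rewrite gt_eqF.
  have h1 := @overlap_bound_le m n h (x / 2 ^+ k) (y / 2 ^+ k) (N %/ 2 ^ k) m0 n0 mh nh
    (divr_ge0 x0 (ltW p2)) (divr_ge0 y0 (ltW p2)).
  rewrite zk in h1.
  have k2 : (0 < 2 ^ k)%N by rewrite expn_gt0.
  have hXk (r : nat) : (r * g)%N%:R < z / 2 ^+ k -> (r <= N %/ 2 ^ k)%N.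
    rewrite ltr_pdivlMr// -natrX -natrM => rz; rewrite leq_divRL//; apply: hN.
    by rewrite mulnAC.
  have Xk : (N %/ 2 ^ k * g)%N%:R <= z / 2 ^+ k.
    rewrite ler_pdivlMr// -natrX -natrM; apply: le_trans Nz.
    by rewrite ler_nat mulnAC leq_mul2r leq_trunc_div orbT.
  have {h1} h1 := h1 hXk Xk.
  have kJ : (0 < N %/ 2 ^ k)%N = (k <= J)%N && (0 < N)%N.
    rewrite divn_gt0//; case: (posnP N) => [->|N0]; first by rewrite andbF leqNgt k2.
    rewrite andbT; apply/idP/idP => h'; first exact: trunc_log_max.
    by apply: (@leq_trans (2 ^ J)%N); rewrite ?leq_exp2l// trunc_logP.
  have h1' := ler_wpM2l (ltW (exprn_gt0 2 p2)) h1.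
  apply: le_trans h1' _; case: ifP => [NX|_]; last first.
    by rewrite mulr0 mulr_ge0// addr_ge0//; case: ifP => // _; rewrite divr_ge0.
  move: (NX); rewrite kJ => /andP[-> _].
  rewrite trunc_log_divn_expn; last by move: NX; rewrite divn_gt0.
  rewrite -/J [leLHS]mulrA ler_wpM2r ?addr_ge0 ?divr_ge0//.
  by rewrite le_eqVlt; apply/orP; left; apply/eqP; field; rewrite gt_eqF.
apply: le_trans (ler_sum _ (fun k _ => term k)) _.
rewrite -mulr_sumr ler_wpM2l// big_split/= sumr_const_nat subn0 lerD2l -big_mkcond/=.
rewrite -mulr_sumr ler_wpM2l//; exact: sum_inv_truncated.
Qed.

(** Pigeonhole: the weight [4^k] undoes the division of both radii by [2^k], so all scales are
    measured against the same [T ^ 2]. The average over [k] is taken after summing over all pairs,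
    so that one scale serves the whole block. *)
Lemma good_scale (B : seq nat) h (psi : nat -> R) K : (0 < K)%N ->
  (forall n, n \in B -> (0 < n < 2 ^ (2 ^ h.+1))%N /\ 0 <= psi n) ->
  exists2 k, (k < K)%N &
    \sum_(m <- B) \sum_(n <- B) overlap_bound m n (psi m / 2 ^+ k) (psi n / 2 ^+ k) <=
    144 * expR 16 * (1 + h%:R * harmonic_sum K / K%:R) *
      ((\sum_(n <- B) rho n * psi n) / 2 ^+ k) ^+ 2.
Proof.
move=> K0 hB; set C := 144 * expR 16; set T := \sum_(n <- B) _.
pose S k := \sum_(m <- B) \sum_(n <- B) overlap_bound m n (psi m / 2 ^+ k) (psi n / 2 ^+ k).
have KR : 0 < K%:R :> R by rewrite ltr0n.
have tot : \sum_(0 <= k < K) (2 ^+ k) ^+ 2 * S k <= C * (K%:R + h%:R * harmonic_sum K) * T ^+ 2.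
  have -> : \sum_(0 <= k < K) (2 ^+ k) ^+ 2 * S k = \sum_(m <- B) \sum_(n <- B)
     \sum_(0 <= k < K) (2 ^+ k) ^+ 2 * overlap_bound m n (psi m / 2 ^+ k) (psi n / 2 ^+ k).
    under eq_bigr do rewrite /S mulr_sumr.
    rewrite exchange_big/=; apply: eq_bigr => m _.
    under eq_bigr do rewrite mulr_sumr.
    by rewrite exchange_big.
  have -> : C * (K%:R + h%:R * harmonic_sum K) * T ^+ 2 = \sum_(m <- B) \sum_(n <- B)
     C * ((rho m * psi m) * (rho n * psi n)) * (K%:R + h%:R * harmonic_sum K).
    rewrite expr2 /T mulr_suml mulr_sumr; apply: eq_bigr => m _.
    by rewrite mulrA mulr_sumr; apply: eq_bigr => n _; ring.
  rewrite big_seq [leRHS]big_seq; apply: ler_sum => m mB.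
  rewrite big_seq [leRHS]big_seq; apply: ler_sum => n nB.
  have [/andP[m0 mh] pm] := hB m mB; have [/andP[n0 nh] pn] := hB n nB.
  exact: overlap_scales.
apply: contrapT => /forall2NP hk.
have : C * (K%:R + h%:R * harmonic_sum K) * T ^+ 2 < \sum_(0 <= k < K) (2 ^+ k) ^+ 2 * S k.
  have -> : C * (K%:R + h%:R * harmonic_sum K) * T ^+ 2 =
      \sum_(0 <= k < K) C * (1 + h%:R * harmonic_sum K / K%:R) * T ^+ 2.
    by rewrite sumr_const_nat subn0 -mulr_natl; field; rewrite gt_eqF.
  apply: ltr_sum_nat => // k /andP[_ kK].
  have p2 : 0 < 2 ^+ k :> R by rewrite exprn_gt0.
  have [//|/negP] := hk k; rewrite -ltNge -/(S k) => lt.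
  have -> : C * (1 + h%:R * harmonic_sum K / K%:R) * T ^+ 2 =
     (2 ^+ k) ^+ 2 * (C * (1 + h%:R * harmonic_sum K / K%:R) * (T / 2 ^+ k) ^+ 2).
    by field; rewrite !gt_eqF.
  by rewrite ltr_pM2l// exprn_gt0.
by rewrite ltNge tot.
Qed.

End Overlap.

(** * Second moments and limsup sets *)

Section SecondMoment.
Context d (T : measurableType d) (R : realType) (mu : {measure set T -> \bar R}).
Local Open Scope ereal_scope.

Lemma integral_sum_indic (I : Type) (s : seq I) (A : I -> set T) (c : R) :
  (0 <= c)%R -> (forall i, measurable (A i)) ->
  \int[mu]_x (c * \sum_(i <- s) \1_(A i) x)%:E = c%:E * \sum_(i <- s) mu (A i).
Proof.
move=> c0 mA.
under eq_integral do rewrite EFinM -sumEFin.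
rewrite ge0_integralZl_EFin//.
- congr (_ * _); rewrite ge0_integral_sum//.
  + by apply: eq_bigr => i _; rewrite integral_indic// setIT.
  + by move=> i; apply/measurable_EFinP; exact: measurable_indic.
- by move=> x _; apply: sume_ge0 => i _; rewrite lee_fin.
- apply: emeasurable_sum => i; apply/measurable_EFinP; exact: measurable_indic.
Qed.

(* [2 t F - F^2 <= t^2 1_U] for the counting function [F] of a family of subsets of [U]; the
   optimal [t] gives the Cauchy-Schwarz bound [mu U >= (int F)^2 / int F^2]. *)
Lemma second_moment (I : eqType) (s : seq I) (A : I -> set T) (U : set T) (t : R) :
  (0 <= t)%R -> (forall i, measurable (A i)) -> measurable U ->
  (forall i, i \in s -> A i `<=` U) ->
  (2 * t)%:E * \sum_(i <- s) mu (A i) <=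
    (t ^+ 2)%:E * mu U + \sum_(i <- s) \sum_(j <- s) mu (A i `&` A j).
Proof.
move=> t0 mA mU AU; rewrite -integral_sum_indic ?mulr_ge0//.
have -> : (t ^+ 2)%:E * mu U = \int[mu]_x (t ^+ 2 * \sum_(i <- [:: U]) \1_i x)%:E.
  pose B (i : unit) := U.
  transitivity (\int[mu]_x (t ^+ 2 * \sum_(i <- [:: tt]) \1_(B i) x)%:E).
    by rewrite integral_sum_indic ?sqr_ge0// big_seq1.
  by apply: eq_integral => x _; rewrite !big_seq1.
have -> : \sum_(i <- s) \sum_(j <- s) mu (A i `&` A j) =
    \int[mu]_x (1 * \sum_(p <- [seq (i, j) | i <- s, j <- s]) \1_(A p.1 `&` A p.2) x)%:E.
  rewrite (@integral_sum_indic (I * I) _ (fun p => A p.1 `&` A p.2))//; last first.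
    by move=> p; exact: measurableI.
  by rewrite mul1e big_allpairs.
have ms (J : Type) (r : seq J) (B : J -> set T) (c : R) : (forall i, measurable (B i)) ->
    measurable_fun [set: T] (fun x => (c * \sum_(i <- r) \1_(B i) x)%:E).
  move=> mB; apply/measurable_EFinP; apply: measurable_funM => //.
  by apply: measurable_sum => i; exact: measurable_indic.
have s0 (J : Type) (r : seq J) (B : J -> set T) x : (0 <= \sum_(i <- r) \1_(B i) x :> R)%R.
  by apply: sumr_ge0 => i _.
rewrite -ge0_integralD//.
- apply: ge0_le_integral => //.
  + by move=> x _; rewrite lee_fin !mulr_ge0.
  + exact: ms.
  + apply: emeasurable_funD; last by apply: ms => p; exact: measurableI.
    apply/measurable_EFinP; apply: measurable_funM => //.
    rewrite [X in measurable_fun _ X](_ : _ = \1_U); last by apply/funext => x; rewrite big_seq1.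
    exact: measurable_indic.
  + move=> x _; rewrite -EFinD lee_fin mul1r big_seq1 big_allpairs.
    have -> : (\sum_(i <- s) \sum_(j <- s) \1_(A (i, j).1 `&` A (i, j).2) x =
       (\sum_(i <- s) \1_(A i) x) ^+ 2 :> R)%R.
      rewrite expr2 mulr_suml; apply: eq_bigr => i _; rewrite mulr_sumr.
      by apply: eq_bigr => j _; rewrite indicI.
    have [xU|xU] := pselect (U x).
      rewrite indicE mem_set// mulr1.
      by move: (\sum_(i <- s) _)%R => z; have := sqr_ge0 (t - z); nra.
    rewrite big1_seq ?mulr0 ?expr0n ?addr0 ?mulr_ge0 ?sqr_ge0// => i /= si.
    by rewrite indicE memNset// => /(AU i si).
- by move=> x _; rewrite lee_fin mulr_ge0 ?sqr_ge0//; exact: s0.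
- apply/measurable_EFinP; apply: measurable_funM => //.
  rewrite [X in measurable_fun _ X](_ : _ = \1_U); last by apply/funext => x; rewrite big_seq1.
  exact: measurable_indic.
- by move=> x _; rewrite lee_fin mul1r; exact: s0.
- by apply: ms => p; exact: measurableI.
Qed.

End SecondMoment.

(** * Lebesgue measure of periodic sets *)

Section Periodic.
Variable R : realType.
Local Notation mu := (@lebesgue_measure R).
Implicit Type A : set R.

Lemma measurable_affine (a b : R) : measurable_fun [set: R] (fun x : R => a * x + b).
Proof. by apply: measurable_funD => //; apply: measurable_funM. Qed.

Lemma lebesgue_measure_affine (a b : R) A : 0 < a -> measurable A ->
  mu ((fun x => a * x + b) @^-1` A) = (a^-1%:E * mu A)%E.
Proof.
move=> a0 mA.
pose f := (fun x : measurableTypeR R => (a * x + b : measurableTypeR R)).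
have mf : measurable_fun setT f by exact: measurable_affine.
have := @lebesgue_measure_unique R (mscale (NngNum (ltW a0)) (pushforward mu f)).
move=> /(_ mf) h; rewrite [in RHS]h//.
  rewrite /mscale/= /pushforward muleA -EFinM mulVf ?gt_eqF// mul1e.
  by [].
move=> _ [[s t] _ <-].
transitivity (a%:E * mu (f @^-1` (`]s, t]%classic : set R)))%E; last by [].
have -> : f @^-1` (`]s, t]%classic : set R) = `](s - b) / a, (t - b) / a]%classic.
  apply/seteqP; split => x /=; rewrite !in_itv/= /f ltr_pdivrMr// ler_pdivlMr//
    ltrBlDr lerBrDr mulrC//.
rewrite !lebesgue_measure_itv/= !lte_fin ltr_pM2r ?invr_gt0// ltrD2r.
case: ifP => _; last by rewrite mule0.
by rewrite -!EFinB -EFinM; congr (_%:E); field; rewrite gt_eqF.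
Qed.

Lemma lebesgue_measure_shift (b : R) A : measurable A ->
  mu ((fun x => x + b) @^-1` A) = mu A.
Proof.
move=> mA; have := lebesgue_measure_affine b ltr01 mA; rewrite invr1 mul1e => <-.
by congr (mu _); apply/seteqP; split => x /=; rewrite mul1r.
Qed.

Lemma periodic_shift_nat A (c : R) : (forall x, A (x + c) <-> A x) ->
  forall (k : nat) x, A (x + k%:R * c) <-> A x.
Proof.
move=> hA; elim=> [|k IH] x; first by rewrite mul0r addr0.
by rewrite -addn1 natrD mulrDl mul1r addrA hA IH.
Qed.

Lemma periodic_shift_int A (c : R) : (forall x, A (x + c) <-> A x) ->
  forall (k : int) x, A (x + k%:~R * c) <-> A x.
Proof.
move=> hA [k|k] x; first exact: periodic_shift_nat.
rewrite -(periodic_shift_nat hA k.+1 (x + _)) NegzE mulrNz mulNr -addrA addNr addr0.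
by [].
Qed.

Lemma measure_periodic_shift A (c : R) (B : set R) : measurable A -> measurable B ->
  (forall x, A (x + c) <-> A x) -> mu (A `&` ((fun x => x - c) @^-1` B)) = mu (A `&` B).
Proof.
move=> mA mB hA; rewrite -[RHS](lebesgue_measure_shift (- c)); last exact: measurableI.
congr (mu _); apply/seteqP; split => x /= [h1 h2]; split => //.
  by apply/hA; rewrite subrK.
by move/hA : h1; rewrite subrK.
Qed.

(** With [k] the floor of [y], both windows share [[y, k + 1[], and the remaining pieces [[k, y[]
    and [[k + 1, y + 1[] are translates by 1. *)
Lemma measure_periodic_window A (y : R) : measurable A -> (forall x, A (x + 1) <-> A x) ->
  mu (A `&` `[y, y + 1[) = mu (A `&` `[0, 1[).
Proof.
move=> mA hA.
have fl := ge_floor y; have fr := floorD1_gt y; rewrite intrD in fr.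
set k := Num.floor y in fl fr.
have hk : forall x, A (x + k%:~R) <-> A x.
  by move=> x; have := periodic_shift_int hA k x; rewrite mulr1.
rewrite -[RHS](measure_periodic_shift mA _ hk)//.
have -> : (fun x => x - k%:~R) @^-1` `[0, 1[ = `[k%:~R, k%:~R + 1[%classic :> set R.
  by apply/seteqP; split => x /=; rewrite !in_itv/= subr_ge0 ltrBlDr [1 + _]addrC.
have mi (a b : R) : measurable (A `&` `[a, b[) by apply: measurableI.
have cut (a b c : R) : a <= b -> b <= c ->
    mu (A `&` `[a, c[) = (mu (A `&` `[a, b[) + mu (A `&` `[b, c[))%E.
  move=> ab bc; rewrite -measureU; [|exact: mi|exact: mi|].
    congr (mu _); apply/seteqP; split => x /=; rewrite !in_itv/=.
      by case=> Ax /andP[ax xc]; case: (ltP x b) => xb; [left|right]; rewrite ?ax ?xb ?xc.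
    case=> -[Ax /andP[ax xb]]; split => //; first by rewrite ax (lt_le_trans xb).
    by rewrite (le_trans ab ax).
  apply/seteqP; split => x //=; rewrite !in_itv/= => -[[_ /andP[_ xb]] [_ /andP[bx _]]].
  by have := lt_le_trans xb bx; rewrite ltxx.
rewrite (cut y (k%:~R + 1))//; [|exact: ltW|by rewrite lerD2r].
rewrite (cut k%:~R y (k%:~R + 1))//; last exact: ltW.
rewrite addeC; congr (_ + _)%E.
rewrite -[RHS](measure_periodic_shift mA _ hA)//; congr (mu (_ `&` _)).
by apply/seteqP; split => x /=; rewrite !in_itv/= lerBrDr ltrBlDr.
Qed.

End Periodic.

(** * Approximation sets on the line *)

Section ApproxLine.
Variable R : realType.
Local Notation mu := (@lebesgue_measure R).
Local Notation rho := (@phi_ratio R).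
Implicit Type psi : nat -> R.

(* The preimage of [approx_set psi n] under the projection of the line onto the circle *)
Definition approx_line psi (n : nat) : set R :=
  [set t | (0 < n)%N /\ exists2 a : int, coprimez a n & `|t * n%:R - a%:~R| < psi n].

Definition approx_itv (x : R) (n a : nat) : set R :=
  `](a%:R - x) / n%:R, (a%:R + x) / n%:R[%classic.

Lemma approx_itvE x n a t : (0 < n)%N -> approx_itv x n a t <-> `|t * n%:R - a%:R| < x.
Proof.
move=> n0; have nR : 0 < n%:R :> R by rewrite ltr0n.
rewrite /approx_itv/= in_itv/= ltr_pdivrMr// ltr_pdivlMr// ltr_norml.
by split=> /andP[h1 h2]; apply/andP; split; lra.
Qed.

Lemma measurable_approx_line psi n : measurable (approx_line psi n).
Proof.
case: (posnP n) => [->|n0].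
  by rewrite (_ : approx_line _ _ = set0)//; apply/seteqP; split => t // -[].
(* The integer numerator is written [k - l], which turns the union into one over pairs of
   naturals. *)
have -> : approx_line psi n = \bigcup_(k in [set: nat]) \bigcup_(l in [set: nat])
   (if coprimez (k%:Z - l%:Z) n then
      `](k%:R - l%:R - psi n) / n%:R, (k%:R - l%:R + psi n) / n%:R[%classic else set0).
  have nR : 0 < n%:R :> R by rewrite ltr0n.
  apply/seteqP; split => t.
    case=> _ [a ca ta].
    have [k [l aE]] : exists k l : nat, a = k%:Z - l%:Z.
      by case: a {ca ta} => a; [exists a, 0%N; rewrite subr0|exists 0%N, a.+1; rewrite NegzE sub0r].
    exists k => //; exists l => //; rewrite -aE ca/= in_itv/= ltr_pdivrMr// ltr_pdivlMr//.
    move: ta; rewrite ltr_norml aE intrB => /andP[h1 h2]; apply/andP; split; lra.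
  case=> k _ [l _]; case: ifP => // ca /=; rewrite in_itv/= ltr_pdivrMr// ltr_pdivlMr// => /andP[h1 h2].
  split => //; exists (k%:Z - l%:Z) => //; rewrite intrB ltr_norml; apply/andP; split; lra.
apply: bigcupT_measurable => k; apply: bigcupT_measurable => l.
by case: ifP => // _; exact: measurable_itv.
Qed.

Lemma coprimez_addMr (q a b : int) : coprimez (a + q * b) b = coprimez a b.
Proof. by rewrite coprimez_sym /coprimez addrC gcdzMDl gcdzC. Qed.

Lemma approx_line_periodic psi n x : approx_line psi n (x + 1) <-> approx_line psi n x.
Proof.
split=> -[n0 [a ca xa]]; split => //.
  exists (a + (-1) * n%:Z); first by rewrite coprimez_addMr.
  by rewrite intrD mulN1r mulrNz; move: xa; rewrite mulrDl mul1r; congr (`|_| < _); lra.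
exists (a + 1 * n%:Z); first by rewrite coprimez_addMr.
by rewrite intrD mul1r; move: xa; rewrite mulrDl mul1r; congr (`|_| < _); lra.
Qed.

Lemma measure_approx_itv x n a : (0 < n)%N -> 0 <= x ->
  mu (approx_itv x n a) = (2 * (x / n%:R))%:E.
Proof.
move=> n0 x0; have nR : 0 < n%:R :> R by rewrite ltr0n.
rewrite /approx_itv lebesgue_measure_itv/= lte_fin ltr_pM2r ?invr_gt0//.
case: ifP => h; first by rewrite -EFinB; congr (_%:E); field; rewrite gt_eqF.
have -> : x = 0 by move/negbT: h; rewrite -leNgt; lra.
by rewrite mul0r mulr0.
Qed.

Lemma measure_approx_itvI x y m n a b : (0 < m)%N -> (0 < n)%N -> 0 <= x -> 0 <= y ->
  (mu (approx_itv x m a `&` approx_itv y n b) <=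
    ((if (a * n != b * m)%N && (`|a%:R * n%:R - b%:R * m%:R| < x * n%:R + y * m%:R)
     then 2 * Num.min (x / m%:R) (y / n%:R) else 0) +
     (if (a * n == b * m)%N then 2 * (x / m%:R) else 0))%:E)%E.
Proof.
move=> m0 n0 x0 y0.
have mR : 0 < m%:R :> R by rewrite ltr0n.
have nR : 0 < n%:R :> R by rewrite ltr0n.
have mi z k c : measurable (approx_itv z k c) by exact: measurable_itv.
have lex : (mu (approx_itv x m a `&` approx_itv y n b) <= (2 * (x / m%:R))%:E)%E.
  rewrite -(measure_approx_itv a m0 x0); apply: le_measure; rewrite ?inE; last exact: subIsetl.
    by apply: measurableI; exact: mi.
  exact: mi.
have ley : (mu (approx_itv x m a `&` approx_itv y n b) <= (2 * (y / n%:R))%:E)%E.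
  rewrite -(measure_approx_itv b n0 y0); apply: le_measure; rewrite ?inE; last exact: subIsetr.
    by apply: measurableI; exact: mi.
  exact: mi.
case: eqP => _ /=; first by rewrite add0r.
rewrite addr0; case: ltP => h.
  by rewrite /Num.min; case: ifP.
rewrite (_ : _ `&` _ = set0) ?measure0//.
apply/seteqP; split => t // -[/(approx_itvE _ _ _ m0) ht1 /(approx_itvE _ _ _ n0) ht2].
move: h; apply/negP; rewrite -ltNge.
have -> : a%:R * n%:R - b%:R * m%:R =
    (t * n%:R - b%:R) * m%:R - (t * m%:R - a%:R) * n%:R by ring.
apply: le_lt_trans (ler_normB _ _) _; rewrite !normrM (gtr0_norm mR) (gtr0_norm nR).
by rewrite addrC ltrD// ltr_pM2r.
Qed.

Lemma sum_coprime_totient n (c : R) : (0 < n)%N ->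
  \sum_(1 <= a < n.+1 | coprime a n) c = (totient n)%:R * c.
Proof.
move=> n0; rewrite totient_count_coprime natr_sum mulr_suml big_mkcond.
have E : \sum_(0 <= a < n.+1) (if coprime a n then c else 0) =
   \sum_(1 <= a < n.+1) (if coprime a n then c else 0) + (if coprime 0 n then c else 0).
  by rewrite big_ltn// addrC.
have E' : \sum_(0 <= a < n.+1) (if coprime a n then c else 0) =
   \sum_(0 <= a < n) (if coprime a n then c else 0) + (if coprime n n then c else 0).
  by rewrite big_nat_recr.
have e0 : coprime n n = coprime 0 n by rewrite /coprime gcdnn gcd0n.
move: E; rewrite E' e0 => /addIr <-; apply: eq_bigr => a _.
by rewrite coprime_sym; case: ifP; rewrite ?mul1r ?mul0r.
Qed.

Lemma coprime_fraction_inj m n a b : (0 < m)%N -> coprime a m -> coprime b n ->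
  (a * n = b * m)%N -> m = n /\ a = b.
Proof.
move=> m0 am bn e.
have mn : m = n.
  apply/eqP; rewrite eqn_dvd -(@Gauss_dvdr m a) 1?coprime_sym// e dvdn_mull//=.
  by rewrite -(@Gauss_dvdr n b) 1?coprime_sym// -e dvdn_mull.
by split=> //; apply/eqP; rewrite -(eqn_pmul2r m0) -e mn.
Qed.

(** Denominator first. The second moment method is run on single intervals rather than on the sets
    [approx_line], so that the first moment is exactly [2 T] even when intervals overlap. *)
Definition reduced_fractions (B : seq nat) : seq (nat * nat) :=
  [seq (n, a) | n <- B, a <- [seq a <- index_iota 1 n.+1 | coprime a n]].

Lemma big_reduced_fractions (B : seq nat) (F : nat * nat -> R) :
  \sum_(p <- reduced_fractions B) F p =
  \sum_(n <- B) \sum_(1 <= a < n.+1 | coprime a n) F (n, a).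
Proof.
rewrite /reduced_fractions big_allpairs_dep; apply: eq_bigr => n _.
by rewrite big_filter.
Qed.

(** The equal centres contribute at most [2 T], which [T >= 1] absorbs into [2 T^2]. The second
    moment [(D + 2) T^2] against the first moment [2 T] makes [t = (D + 2) T / 2] optimal in
    [second_moment]. *)
Lemma block_measure (B : seq nat) (x : nat -> R) (D : R) (U : set R) : uniq B -> 0 <= D ->
  (forall n, n \in B -> (0 < n)%N /\ 0 <= x n) ->
  1 <= \sum_(n <- B) rho n * x n ->
  \sum_(m <- B) \sum_(n <- B) overlap_bound m n (x m) (x n) <= D * (\sum_(n <- B) rho n * x n) ^+ 2 ->
  measurable U ->
  (forall n a, n \in B -> (1 <= a <= n)%N -> coprime a n -> approx_itv (x n) n a `<=` U) ->
  ((4 / (2 + D))%:E <= mu U)%E.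
Proof.
move=> uB D0 hB; set T := \sum_(n <- B) rho n * x n => T1 hT mU hU.
pose s := reduced_fractions B.
have sP p : p \in s -> [/\ p.1 \in B, (1 <= p.2 <= p.1)%N & coprime p.2 p.1].
  case/allpairsPdep => n [a [nB]]; rewrite mem_filter mem_index_iota => /and3P[ca a1 an] ->/=.
  by rewrite nB a1 -ltnS an ca.
pose A (p : nat * nat) := approx_itv (x p.1) p.1 p.2.
have mA p : measurable (A p) by exact: measurable_itv.
have sumT : \sum_(p <- s) (2 * (x p.1 / p.1%:R)) = 2 * T.
  rewrite big_reduced_fractions /T mulr_sumr.
  rewrite big_seq [RHS]big_seq; apply: eq_bigr => n nB; have [n0 _] := hB n nB.
  by rewrite /= sum_coprime_totient// /phi_ratio; field; rewrite pnatr_eq0 -lt0n.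
have sumA : (\sum_(p <- s) mu (A p) = (2 * T)%:E)%E.
  rewrite -sumT -sumEFin big_seq [RHS]big_seq; apply: eq_bigr => p /sP[pB _ _].
  by have [? ?] := hB _ pB; rewrite measure_approx_itv.
have sumAA : (\sum_(p <- s) \sum_(q <- s) mu (A p `&` A q) <= ((D + 2) * T ^+ 2)%:E)%E.
  pose F (p q : nat * nat) : R :=
    (if (p.2 * q.1 != q.2 * p.1)%N && (`|p.2%:R * q.1%:R - q.2%:R * p.1%:R| < x p.1 * q.1%:R + x q.1 * p.1%:R)
     then 2 * Num.min (x p.1 / p.1%:R) (x q.1 / q.1%:R) else 0).
  pose G (p q : nat * nat) : R := if (p.2 * q.1 == q.2 * p.1)%N then 2 * (x p.1 / p.1%:R) else 0.
  apply: (@le_trans _ _ (\sum_(p <- s) \sum_(q <- s) (F p q + G p q)%:E)%E).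
    rewrite big_seq [leRHS]big_seq; apply: lee_sum => p /sP[pB _ _].
    rewrite big_seq [leRHS]big_seq; apply: lee_sum => q /sP[qB _ _].
    have [? ?] := hB _ pB; have [? ?] := hB _ qB.
    exact: measure_approx_itvI.
  under eq_bigr do rewrite sumEFin.
  rewrite sumEFin lee_fin.
  under eq_bigr do rewrite big_split/=.
  rewrite big_split/= mulrDl lerD//.
    apply: le_trans hT; rewrite le_eqVlt; apply/orP; left; apply/eqP.
    rewrite big_reduced_fractions; apply: eq_bigr => m _.
    under eq_bigr do rewrite big_reduced_fractions.
    rewrite exchange_big/=; apply: eq_bigr => n _; rewrite /overlap_bound.
    by apply: eq_bigr.
  apply: (@le_trans _ _ (2 * T)); last by rewrite expr2; nra.
  rewrite -sumT.
  rewrite big_seq [leRHS]big_seq; apply: ler_sum => p ps; have [pB _ cp] := sP p ps.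
  have [p0 xp] := hB _ pB.
  have us : uniq s.
    apply: allpairs_uniq_dep => // [n _|]; first by rewrite filter_uniq// iota_uniq.
    by move=> [n a] [n' a'] _ _ /= [-> ->].
  rewrite (bigD1_seq p)//= big1_seq ?addr0.
    by rewrite /G; case: ifP => // _; rewrite mulr_ge0// divr_ge0.
  move=> q /andP[qp qs]; have [qB _ cq] := sP q qs; rewrite /G; case: eqP => // e.
  have [e1 e2] := coprime_fraction_inj p0 cp cq e.
  by move: qp; rewrite (surjective_pairing q) (surjective_pairing p) e1 e2 eqxx.
have t0 : 0 <= (D + 2) * T / 2 by rewrite divr_ge0// mulr_ge0; lra.
have AU p : p \in s -> A p `<=` U by move=> /sP[pB pp cp]; exact: hU.
have h : ((2 * ((D + 2) * T / 2))%:E * (2 * T)%:E <=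
    (((D + 2) * T / 2) ^+ 2)%:E * mu U + ((D + 2) * T ^+ 2)%:E)%E.
  have h1 := @second_moment _ _ R mu _ s A U ((D + 2) * T / 2) t0 mA mU AU.
  by rewrite sumA in h1; apply: le_trans h1 (leeD2l _ sumAA).
have mU0 : (0 <= mu U)%E by exact: measure_ge0.
have t1 : 0 < ((D + 2) * T / 2) ^+ 2 by rewrite exprn_gt0// divr_gt0// mulr_gt0//; lra.
move: h mU0; case: (mu U) => [r||]; [|by move=> _ _; rewrite leey|by move=> _; rewrite leeNy_eq].
rewrite -!EFinM -EFinD !lee_fin => h r0.
rewrite ler_pdivrMr; last by lra.
have T0 : 0 < T by lra.
have : 2 * ((D + 2) * T / 2) * (2 * T) - (D + 2) * T ^+ 2 <= ((D + 2) * T / 2) ^+ 2 * r by lra.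
have -> : 2 * ((D + 2) * T / 2) * (2 * T) - (D + 2) * T ^+ 2 = (D + 2) * T ^+ 2 * 1 by field.
have -> : ((D + 2) * T / 2) ^+ 2 * r = (D + 2) * T ^+ 2 * ((D + 2) * r / 4) by field.
rewrite ler_pM2l ?mulr_gt0 ?exprn_gt0//; lra.
Qed.

End ApproxLine.

(** * Limsup sets of positive measure *)

Section Core.
Variable R : realType.
Local Notation mu := (@lebesgue_measure R).
Local Notation rho := (@phi_ratio R).
Implicit Type psi : nat -> R.

Definition block (h : nat) : seq nat := index_iota (2 ^ (2 ^ h)) (2 ^ (2 ^ h.+1)).

(** [q] is the trade-off parameter: a larger [q] makes [2 ^ num_scales] small enough for the
    exponential with a given [c], and worsens the quasi-independence constant by a factor of order
    [q]. *)
Definition num_scales (q h : nat) : nat := ((h * trunc_log 2 h) %/ q)%N.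

Lemma mem_block h n : (n \in block h) = (2 ^ (2 ^ h) <= n < 2 ^ (2 ^ h.+1))%N.
Proof. exact: mem_index_iota. Qed.

Lemma block_gt0 h n : n \in block h -> (0 < n)%N.
Proof. by rewrite mem_block => /andP[+ _]; apply: leq_trans; rewrite expn_gt0. Qed.

Lemma harmonic_sum_scales q h : (0 < q)%N -> (2 * q <= h)%N ->
  (0 < num_scales q h)%N /\
  h%:R * harmonic_sum R (num_scales q h) / (num_scales q h)%:R <= 10 * q%:R.
Proof.
move=> q0 qh; set L := trunc_log 2 h; set K := num_scales q h.
have h2 : (1 < h)%N by lia.
have L1 : (0 < L)%N by rewrite trunc_log_gt0.
have hL : (2 * q <= h * L)%N by nia.
have K0 : (0 < K)%N by rewrite divn_gt0//; lia.
have K2 : (h * L <= 2 * q * K)%N.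
  by have := ltn_ceil (h * L) q0; rewrite -/K /num_scales -/L -/(num_scales q h) -/K; nia.
split=> //.
have KR : 0 < K%:R :> R by rewrite ltr0n.
have Kh : (K <= h ^ 2)%N.
  apply: leq_trans (leq_div _ _) _; rewrite expnS expn1 leq_mul2l.
  by rewrite -/L ltnW ?orbT//; apply: (@leq_trans (2 ^ L)); [exact: ltn_expl|rewrite trunc_logP//; lia].
have lnh : ln h%:R <= L%:R + 1 :> R.
  have : ln h%:R <= ln (2 ^ L.+1)%:R :> R.
    by rewrite ler_ln ?posrE ?ltr0n ?expn_gt0//; [rewrite ler_nat ltnW// trunc_log_ltn|lia].
  rewrite natrX lnXn// -[X in _ <= X]mulr_natl => /le_trans; apply.
  have := @ln_le_sub1 R 2 ltac:(by []); rewrite -[L.+1]addn1 natrD => l2.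
  have : 0 <= L%:R + 1 :> R by rewrite addr_ge0.
  by move: (L%:R) (ln 2) l2 => a b; nra.
have HK : harmonic_sum R K <= 5 * L%:R.
  apply: le_trans (harmonic_le_ln R K0) _.
  have : ln K%:R <= ln (h ^ 2)%:R :> R.
    by rewrite ler_ln ?posrE ?ltr0n ?expn_gt0 ?ler_nat//; lia.
  rewrite natrX lnXn ?ltr0n//; last by lia.
  have : 1 <= L%:R :> R by rewrite ler1n.
  rewrite mulr2n; lra.
rewrite ler_pdivrMr//.
have hR : 0 <= h%:R :> R by [].
apply: le_trans (ler_wpM2l hR HK) _.
have : (h * L)%N%:R <= (2 * q * K)%N%:R :> R by rewrite ler_nat.
by rewrite !natrM; lra.
Qed.

(* [D = 144 * expR 16 * (1 + 10 q)] is the quasi-independence constant at the good scale; the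
   factor 3 comes from folding [-1, 2[ onto [0, 1[. *)
Definition core_const (q : nat) : R := 4 / (2 + 144 * expR 16 * (1 + 10 * q%:R)) / 3.

Lemma core_const_gt0 q : 0 < core_const q.
Proof.
by rewrite /core_const !divr_gt0// addr_gt0// !mulr_gt0 ?expR_gt0// ltr_wpDr// mulr_ge0.
Qed.

Lemma approx_itv_window n a (x : R) : (1 <= a <= n)%N -> 0 <= x <= n%:R ->
  approx_itv x n a `<=` `[-1, 2[.
Proof.
move=> /andP[a1 an] /andP[x0 xn] t; have n0 : (0 < n)%N by lia.
have nR : 0 < n%:R :> R by rewrite ltr0n.
move/(approx_itvE _ _ _ n0); rewrite ltr_norml => /andP[h1 h2].
have a1R : 1 <= a%:R :> R by rewrite ler1n.
have anR : a%:R <= n%:R :> R by rewrite ler_nat.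
rewrite /= in_itv/=; apply/andP; split.
  by rewrite -(ler_pM2r nR); lra.
by rewrite -(ltr_pM2r nR); lra.
Qed.

Lemma approx_itv_sub psi n a (x : R) : (0 < n)%N -> coprime a n -> x <= psi n ->
  approx_itv x n a `<=` approx_line psi n.
Proof.
move=> n0 ca xp t /(approx_itvE _ _ _ n0) ta; split => //; exists a%:Z => //.
exact: lt_le_trans ta xp.
Qed.

Lemma block_union_measure psi q h : (0 < q)%N -> (2 * q <= h)%N ->
  (forall n, (0 < n)%N -> 0 <= psi n <= n%:R) ->
  (2 ^ num_scales q h)%:R <= \sum_(n <- block h) rho n * psi n ->
  ((core_const q)%:E <=
    mu ((\bigcup_(n in [set n | n \in block h]) approx_line psi n) `&` `[0%R, 1%R[))%E.
Proof.
move=> q0 qh hpsi hT; have [K0 HK] := harmonic_sum_scales q0 qh.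
set K := num_scales q h in hT K0 HK.
have hB n : n \in block h -> (0 < n < 2 ^ (2 ^ h.+1))%N /\ 0 <= psi n.
  move=> nB; have n0 := block_gt0 nB; have /andP[p0 _] := hpsi n n0.
  by move: nB; rewrite n0 mem_block => /andP[_ ->].
have [k kK hk] := good_scale K0 hB.
pose x n := psi n / 2 ^+ k.
set T := \sum_(n <- block h) rho n * psi n in hT hk.
have p2 : 0 < 2 ^+ k :> R by rewrite exprn_gt0.
have TE : \sum_(n <- block h) rho n * x n = T / 2 ^+ k.
  by rewrite /T mulr_suml; apply: eq_bigr => n _; rewrite /x mulrA.
pose D : R := 144 * expR 16 * (1 + 10 * q%:R).
have c0 : 0 <= 144 * expR 16 :> R by rewrite mulr_ge0// expR_ge0.
have D0 : 0 <= D by rewrite mulr_ge0// addr_ge0// mulr_ge0.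
set E := \bigcup_(n in _) _.
have mE : measurable E by apply: bigcup_measurable => n _; exact: measurable_approx_line.
have perE y : E (y + 1) <-> E y.
  by split=> -[n nB /approx_line_periodic yn]; exists n => //; apply/approx_line_periodic.
(* The intervals at scale [k] are shorter than the original ones, so they stay inside [E]; since
   [psi n <= n], they leave [[0, 1]] by at most 1 on either side. *)
have h1 : ((4 / (2 + D))%:E <= mu (E `&` `[(-1)%R, 2%R[))%E.
  apply: (@block_measure R (block h) x D) => //.
  - exact: iota_uniq.
  - move=> n nB; have [/andP[n0 _] pn] := hB n nB; split => //.
    by rewrite divr_ge0// ltW.
  - rewrite TE ler_pdivlMr// mul1r; apply: le_trans hT.
    by rewrite -natrX ler_nat leq_exp2l// ltnW.
  - rewrite TE; apply: le_trans hk _; rewrite ler_wpM2r ?sqr_ge0//.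
    by rewrite ler_wpM2l// lerD2l.
  - by apply: measurableI => //; exact: measurable_itv.
  - move=> n a nB an ca; have n0 := block_gt0 nB.
    have /andP[p0 pn] := hpsi n n0.
    have xp : x n <= psi n.
      by rewrite ler_pdivrMr// ler_peMr// exprn_ege1// ler1n.
    have x0 : 0 <= x n <= n%:R by rewrite divr_ge0 ?(ltW p2)//= (le_trans xp).
    move=> t ta; split; last exact: (approx_itv_window an x0 ta).
    exists n => //; exact: (approx_itv_sub n0 ca xp ta).
have mi (a b : R) : measurable (E `&` `[a, b[) by apply: measurableI => //; exact: measurable_itv.
have w := measure_periodic_window _ mE perE.
pose X := mu (E `&` `[0, 1[).
have cut : (mu (E `&` `[(-1)%R, 2%R[) <= X + (X + X))%E.
  have sub : E `&` `[-1, 2[ `<=` (E `&` `[-1, -1 + 1[) `|` ((E `&` `[0, 0 + 1[) `|` (E `&` `[1, 1 + 1[)).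
    move=> t [Et]; rewrite /= in_itv/= => /andP[t1 t2].
    case: (ltP t 0) => t0; first by left; rewrite /= in_itv/=; split => //; apply/andP; split; lra.
    case: (ltP t 1) => t3; first by right; left; rewrite /= in_itv/=; split => //; apply/andP; split; lra.
    by right; right; rewrite /= in_itv/=; split => //; apply/andP; split; lra.
  have m2 : measurable ((E `&` `[0%R, (0 + 1)%R[) `|` (E `&` `[1%R, (1 + 1)%R[)).
    by apply: measurableU; exact: mi.
  have m3 := measurableU _ _ (mi (-1) (-1 + 1)) m2.
  have /le_trans := le_measure mu (mem_set (mi (-1) 2)) (mem_set m3) sub; apply.
  have muU (A B : set R) : measurable A -> measurable B -> (mu (A `|` B) <= mu A + mu B)%E.
    by move=> mA mB; exact: measureU2.
  have /le_trans := muU _ _ (mi (-1) (-1 + 1)) m2; apply.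
  rewrite (w (-1)) -/X; apply: leeD2l.
  have /le_trans := muU _ _ (mi 0 (0 + 1)) (mi 1 (1 + 1)); apply.
  by rewrite (w 0) (w 1).
have X0 : (0 <= X)%E by exact: measure_ge0.
have {cut} := le_trans h1 cut; rewrite -/X; move: X0; case: X => [r||]; [|by move=> _ _; rewrite leey|by rewrite leeNy_eq].
rewrite !lee_fin => r0 h2; rewrite /core_const -/D ler_pdivrMr//; lra.
Qed.

Lemma bigcup_block_sub psi (N h : nat) : (N <= h)%N ->
  \bigcup_(n in [set n | n \in block h]) approx_line psi n `<=` \bigcup_(n >= N) approx_line psi n.
Proof.
move=> Nh t [n nB tn]; exists n => //=; move: nB; rewrite /= mem_block => /andP[hn _].
apply: leq_trans hn; apply: leq_trans Nh _; apply: ltnW.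
by apply: leq_trans (ltn_expl h (ltnSn 1)) _; apply: ltnW; exact: ltn_expl.
Qed.

Lemma measurable_lim_sup_approx psi : measurable (lim_sup_set (approx_line psi)).
Proof.
apply: bigcap_measurable => // n _; apply: bigcup_measurable => k _.
exact: measurable_approx_line.
Qed.

(** Every tail union contains a heavy block, which alone has measure at least [core_const];
    continuity from above passes the bound to the limsup. *)
Lemma lim_sup_measure_ge psi q : (0 < q)%N ->
  (forall n, (0 < n)%N -> 0 <= psi n <= n%:R) ->
  (forall h0, exists2 h, (h0 <= h)%N &
     (2 ^ num_scales q h)%:R <= \sum_(n <- block h) rho n * psi n) ->
  ((core_const q)%:E <= mu (lim_sup_set (approx_line psi) `&` `[0%R, 1%R[))%E.
Proof.
move=> q0 hpsi hinf; pose F n := approx_line psi n `&` `[0, 1[.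
have mF n : measurable (F n).
  by apply: measurableI; [exact: measurable_approx_line|exact: measurable_itv].
have E : lim_sup_set (approx_line psi) `&` `[0, 1[ = lim_sup_set F.
  apply/seteqP; split => t.
    by move=> [h1 h2] n _; have [k nk tk] := h1 n I; exists k.
  move=> h; split; last by have [k _ []] := h 0%N I.
  by move=> n _; have [k nk [tk _]] := h n I; exists k.
have mU N : measurable (\bigcup_(k >= N) F k) by apply: bigcup_measurable => k _; exact: mF.
have fin : (mu (\bigcup_(k >= 0) F k) < +oo)%E.
  apply: (@le_lt_trans _ _ (mu `[0%R, 1%R[)).
    by apply: le_measure; rewrite ?inE; [exact: mU|exact: measurable_itv|move=> t [k _ []]].
  by rewrite lebesgue_measure_itv/= lte_fin ltr01 -EFinB ltry.
have cv := lim_sup_set_cvg mu F mF fin.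
rewrite E -(cvg_lim _ cv)//; apply: lime_ge; first by apply/cvg_ex; eexists; exact: cv.
apply: nearW => N; have [h Nh hT] := hinf (maxn N (2 * q)).
have := block_union_measure q0 (leq_trans (leq_maxr _ _) Nh) hpsi hT.
move=> /le_trans; apply; apply: le_measure; rewrite ?inE; [|exact: mU|].
  apply: measurableI; last exact: measurable_itv.
  by apply: bigcup_measurable => n _; exact: measurable_approx_line.
move=> t [/(bigcup_block_sub (leq_trans (leq_maxl _ _) Nh)) [k Nk tk] t01].
by exists k.
Qed.

End Core.

(** * From positive to full measure *)

Section ZeroOne.
Variable R : realType.
Local Notation mu := (@lebesgue_measure R).
Implicit Type A : set R.

Lemma measurable_window A (a b : R) : measurable A -> measurable (A `&` `[a, b[).
Proof. by move=> mA; apply: measurableI => //; exact: measurable_itv. Qed.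

Lemma exists_density_point A : measurable A -> (0 < mu (A `&` `[0%R, 1%R[))%E ->
  exists2 x, A x & (mu (A `&` ball x r) * (mu (ball x r))^-1)%E @[r --> 0^'+] --> (1%R)%:E.
Proof.
move=> mA A0; apply: contrapT => /forall2NP h.
have [N [mN N0 hN]] := lebesgue_density mA.
have : (mu (A `&` `[0%R, 1%R[) <= mu N)%E.
  apply: le_measure; rewrite ?inE; [exact: measurable_window|exact: mN|].
  move=> x [Ax _]; apply: hN => /= hx; have [//|] := h x; apply.
  by move: hx; rewrite indicE mem_set.
by rewrite N0 leNgt A0.
Qed.

(** A small ball of radius [2^-j] around a density point misses less than the proportion [e / 2] of
    its length [2 * 2^-j], so its right half misses at most [e * 2^-j]. *)
Lemma dyadic_density A (e : R) : 0 < e -> measurable A -> (0 < mu (A `&` `[0%R, 1%R[))%E ->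
  exists (x : R) (j : nat), (((1 - e) / 2 ^+ j)%:E <= mu (A `&` `[x, (x + (2 ^+ j)^-1)%R[))%E.
Proof.
move=> e0 mA A0; have [x Ax hx] := exists_density_point mA A0.
have nb : nbhs ((1%R)%:E : \bar R) [set y | ((1 - e / 2)%:E < y)%E].
  apply: open_nbhs_nbhs; split; first exact: open_ereal_gt_ereal.
  by rewrite /= lte_fin; lra.
have [d /= d0 hd] := hx _ nb.
pose j := (Num.trunc d^-1).+1; pose r : R := (2 ^+ j)^-1.
have p2 : 0 < 2 ^+ j :> R by rewrite exprn_gt0.
have r0 : 0 < r by rewrite invr_gt0.
have rd : r < d.
  rewrite -[d]invrK ltf_pV2 ?posrE ?invr_gt0//.
  apply: lt_le_trans (truncnS_gt _) _.
  by rewrite -natrX ler_nat ltnW// ltn_expl.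
exists x, j; have := hd r; rewrite /= sub0r normrN gtr0_norm// => /(_ rd r0).
rewrite (lebesgue_measure_ball _ (ltW r0)) => hr; rewrite -/r.
have mb : measurable (ball x r : set R) by exact: measurable_ball.
have fin (B : set R) (a b : R) : measurable B -> a <= b -> (mu (B `&` `[a, b[) <= (b - a)%:E)%E.
  move=> mB ab; have -> : (b - a)%:E = mu `[a, b[.
    rewrite lebesgue_measure_itv/= lte_fin; case: ltP => // ba.
    by have -> : a = b by [apply/eqP; rewrite eq_le ab]; rewrite subrr.
  apply: le_measure; rewrite ?inE; [exact: measurable_window|exact: measurable_itv|exact: subIsetr].
have sub : A `&` ball x r `<=` (A `&` `[x - r, x[) `|` (A `&` `[x, x + r[).
  move=> y [Ay]; rewrite ball_itv /= in_itv/= => /andP[y1 y2].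
  case: (ltP y x) => yx; [left|right]; split => //; rewrite /= in_itv/= ?yx ?y2 ?andbT//.
  exact: ltW.
have h1 : (mu (A `&` ball x r) <= mu (A `&` `[(x - r)%R, x[) + mu (A `&` `[x, (x + r)%R[))%E.
  have m1 := measurable_window (x - r) x mA; have m2 := measurable_window x (x + r) mA.
  have : (mu ((A `&` `[(x - r)%R, x[) `|` (A `&` `[x, (x + r)%R[)) <=
      mu (A `&` `[(x - r)%R, x[) + mu (A `&` `[x, (x + r)%R[))%E by exact: measureU2.
  apply: le_trans; apply: le_measure; rewrite ?inE//; first exact: measurableI.
  exact: measurableU.
have h2 := fin A (x - r) x mA ltac:(lra).
have h3 := fin A x (x + r) mA ltac:(lra).
have h4 : (0 <= mu (A `&` `[x, (x + r)%R[))%E by exact: measure_ge0.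
have h5 : (0 <= mu (A `&` `[(x - r)%R, x[))%E by exact: measure_ge0.
have h6 : (0 <= mu (A `&` ball x r))%E by exact: measure_ge0.
move: h1 h2 h3 h4 h5 h6 hr.
case: (mu (A `&` `[x, (x + r)%R[)) => [s||]//; case: (mu (A `&` `[(x - r)%R, x[)) => [t||]//.
case: (mu (A `&` ball x r)) => [w||]//.
rewrite inver mulrn_eq0/= gt_eqF//= -EFinD -EFinM !lee_fin lte_fin => h1 h2 h3 h4 h5 h6.
rewrite ltr_pdivlMr ?mulrn_wgt0// -[r *+ 2]mulr_natr -/r => h7.
have e1 : 0 < e * r by rewrite mulr_gt0.
nra.
Qed.

(** The [j]-th iterate has the form [y |-> 2^j y + b] and stretches an almost full interval of
    length [2^-j] onto a whole period, which is therefore almost full as well. *)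
Lemma forward_invariant_full A (c : R) : measurable A -> (forall x, A (x + 1) <-> A x) ->
  (forall x, A x -> A (2 * x + c)) -> (0 < mu (A `&` `[0%R, 1%R[))%E ->
  mu (A `&` `[0%R, 1%R[) = 1%E.
Proof.
move=> mA hA hS A0.
have le1 : (mu (A `&` `[0%R, 1%R[) <= 1)%E.
  have -> : 1%E = mu `[0%R, 1%R[ by rewrite lebesgue_measure_itv/= lte_fin ltr01 -EFinB subr0.
  apply: le_measure; rewrite ?inE; [exact: measurable_window|exact: measurable_itv|exact: subIsetr].
apply/eqP; rewrite eq_le le1/=; move: (A0) le1.
case E : (mu (A `&` `[0%R, 1%R[)) => [s||]//; rewrite !lte_fin !lee_fin => s0 s1.
rewrite leNgt; apply/negP => slt.
have [x [j hj]] := dyadic_density (ltac:(lra) : 0 < (1 - s) / 2) mA A0.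
have [b hb] : exists b, forall y, A y -> A (2 ^+ j * y + b).
  elim: (j) => [|i [b hb]]; first by exists 0 => y; rewrite expr0 mul1r addr0.
  exists (2 * b + c) => y /hb /hS; rewrite exprS mulrDr !mulrA addrA//.
have p2 : 0 < 2 ^+ j :> R by rewrite exprn_gt0.
pose z := 2 ^+ j * x + b.
have sub : A `&` `[x, (x + (2 ^+ j)^-1)%R[ `<=`
    (fun y => 2 ^+ j * y + b) @^-1` (A `&` `[z, (z + 1)%R[).
  move=> y [Ay]; rewrite /= in_itv/= => /andP[y1 y2]; split; first exact: hb.
  rewrite in_itv/= /z lerD2r ler_pM2l// y1/= addrAC ltrD2r.
  by move: y2; rewrite -(ltr_pM2l p2) mulrDr divff ?gt_eqF.
have mz := measurable_window z (z + 1) mA.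
have m1 := measurable_window x (x + (2 ^+ j)^-1) mA.
have m2 : measurable ((fun y => 2 ^+ j * y + b) @^-1` (A `&` `[z, (z + 1)%R[)).
  by rewrite -[X in measurable X]setTI; exact: measurable_affine.
have h : (mu (A `&` `[x, (x + (2 ^+ j)^-1)%R[) <=
    mu ((fun y => (2 ^+ j * y + b)%R) @^-1` (A `&` `[z, (z + 1)%R[)))%E.
  by apply: le_measure; rewrite ?inE.
rewrite (lebesgue_measure_affine b p2 mz) (measure_periodic_window z mA hA) E in h.
have := le_trans hj h; rewrite -EFinM lee_fin mulrC ler_pM2l ?invr_gt0//; lra.
Qed.

Lemma measure_periods A (c x : R) (k : nat) : 0 < c -> measurable A ->
  (forall y, A (y + c) <-> A y) ->
  mu (A `&` `[x, (x + k%:R * c)%R[) = (k%:R%:E * mu (A `&` `[x, (x + c)%R[))%E.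
Proof.
move=> c0 mA hA; elim: k => [|k IH].
  by rewrite mul0r addr0 mul0e set_itvco0 setI0 measure0.
have cut : A `&` `[x, x + k.+1%:R * c[ =
    (A `&` `[x, x + k%:R * c[) `|` (A `&` `[x + k%:R * c, x + k.+1%:R * c[).
  have h0 : 0 <= k%:R * c by rewrite mulr_ge0// ltW.
  have h1 : k.+1%:R * c = k%:R * c + c by rewrite -addn1 natrD mulrDl mul1r.
  apply/seteqP; split => t /=; rewrite !in_itv/= h1.
    by case=> At /andP[t1 t2]; case: (ltP t (x + k%:R * c)) => tk; [left|right]; rewrite ?t1 ?t2.
  by case=> -[At /andP[t1 t2]]; split => //; apply/andP; split => //; lra.
rewrite cut measureU; [|exact: measurable_window|exact: measurable_window|]; last first.
  apply/seteqP; split => t //=; rewrite !in_itv/= => -[[_ /andP[_ t1]] [_ /andP[t2 _]]].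
  by have := lt_le_trans t1 t2; rewrite ltxx.
rewrite [X in (X + _)%E]IH -addn1 natrD EFinD ge0_muleDl ?lee_fin// mul1e; congr (_ + _)%E.
have hk y : A (y + k%:R * c) <-> A y by exact: periodic_shift_nat.
rewrite -(measure_periodic_shift mA _ hk); last exact: measurable_itv.
congr (mu (_ `&` _)); apply/seteqP; split => t /=; rewrite !in_itv/= mulrDl mul1r;
  by move=> /andP[h1 h2]; apply/andP; split; lra.
Qed.

(** Each interval of length [2^-j] carries [2^-j] times the measure of [W] in a period, hence at
    least [c0 * 2^-j]; the complement of [A] cannot fill it up to the proportion [c0 / 2]. That [c0]
    does not depend on [j] is essential, as [j] is given by the density point. *)
Lemma small_periods_full A (c0 : R) : 0 < c0 -> measurable A ->
  (forall j : nat, exists W : set R, [/\ measurable W, W `<=` A,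
     (forall y, W (y + (2 ^+ j)^-1) <-> W y) & (c0%:E <= mu (W `&` `[0%R, 1%R[))%E]) ->
  mu (A `&` `[0%R, 1%R[) = 1%E.
Proof.
move=> c00 mA hW; have mC : measurable (~` A) by exact: measurableC.
have I1 : mu `[0%R, 1%R[ = 1%E by rewrite lebesgue_measure_itv/= lte_fin ltr01 -EFinB subr0.
have split1 (x y : R) (B : set R) : measurable B ->
    mu `[x, y[ = (mu (B `&` `[x, y[) + mu (~` B `&` `[x, y[))%E.
  move=> mB; rewrite -measureU; [|exact: measurable_window|apply: measurable_window; exact: measurableC|].
    by rewrite -setIUl setUCr setTI.
  by rewrite setIACA setICr set0I.
have [C0|C0] := pselect (mu (~` A `&` `[0%R, 1%R[) = 0%E).
  by rewrite -I1 (split1 0 1 A mA) [X in (_ + X)%E]C0 adde0.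
exfalso; have Cpos : (0 < mu (~` A `&` `[0%R, 1%R[))%E.
  by rewrite lt_neqAle measure_ge0 andbT eq_sym; apply/eqP.
have [x [j hj]] := dyadic_density (ltac:(lra) : 0 < c0 / 2) mC Cpos.
have [W [mW WA Wj W0]] := hW j.
have p2 : 0 < 2 ^+ j :> R by rewrite exprn_gt0.
have i2 : 0 < (2 ^+ j)^-1 :> R by rewrite invr_gt0.
have W1 y : W (y + 1) <-> W y.
  have := periodic_shift_nat Wj (2 ^ j) y.
  by rewrite natrX divff ?gt_eqF.
have := measure_periods x (2 ^ j) i2 mW Wj.
rewrite natrX divff ?gt_eqF// (measure_periodic_window x mW W1) => e.
rewrite e in W0.
have le2 : (mu (W `&` `[x, (x + (2 ^+ j)^-1)%R[) <= mu (A `&` `[x, (x + (2 ^+ j)^-1)%R[))%E.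
  by apply: le_measure; rewrite ?inE; [exact: measurable_window|exact: measurable_window|exact: setSI].
have := split1 x (x + (2 ^+ j)^-1) A mA.
rewrite lebesgue_measure_itv/= lte_fin ltrDl i2 -EFinB addrAC subrr add0r.
have h4 : (0 <= mu (W `&` `[x, (x + (2 ^+ j)^-1)%R[))%E by exact: measure_ge0.
have h5 : (0 <= mu (A `&` `[x, (x + (2 ^+ j)^-1)%R[))%E by exact: measure_ge0.
have h6 : (0 <= mu (~` A `&` `[x, (x + (2 ^+ j)^-1)%R[))%E by exact: measure_ge0.
move: h4 h5 h6 le2 W0 hj.
case: (mu (W `&` _)) => [s||]//; case: (mu (A `&` _)) => [t||]//; case: (mu (~` A `&` _)) => [w||]//.
rewrite -EFinM -EFinD !lee_fin => h4 h5 h6 h7 h8 h9 [h10].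
have : c0 / 2 ^+ j <= s by rewrite ler_pdivrMr// mulrC.
have : 0 < c0 / 2 ^+ j by rewrite divr_gt0.
move: h9; rewrite mulrBl mul1r; lra.
Qed.

End ZeroOne.

(** * Heavy blocks from divergence *)

Section Series.
Variable R : realType.
Local Notation rho := (@phi_ratio R).
Implicit Types (u v psi : nat -> R) (P : pred nat).

(** Divergence of a series of nonnegative terms, stated through finite sums so that comparison,
    restriction and splitting stay elementary. *)
Definition unbounded_sum u := forall M : R, exists N : nat, M < \sum_(0 <= n < N) u n.

Lemma unbounded_sum_of_dvg u m : (forall n, (m <= n)%N -> 0 <= u n) ->
  ~ cvgn (fun N => \sum_(m <= n < N) u n) -> unbounded_sum (fun n => if (m <= n)%N then u n else 0).
Proof.
move=> u0 dv M; apply: contrapT => /forallNP h; apply: dv.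
apply: nondecreasing_is_cvgn.
  apply/nondecreasing_seqP => N; case: (leqP m N) => mN; last by rewrite !big_geq// ltnW.
  by rewrite big_nat_recr//= lerDl u0.
exists M => _ [N _ <-]; have /negP := h N; rewrite -leNgt; apply: le_trans.
case: (leqP m N) => mN; last first.
  by rewrite big_geq ?(ltnW mN)// sumr_ge0// => n _; case: ifP => // /u0.
rewrite (@big_cat_nat _ _ _ m 0 N)//= [X in X + _]big1_seq ?add0r; last first.
  by move=> n /=; rewrite mem_index_iota => /andP[_ nm]; rewrite leqNgt nm.
by apply: ler_sum_nat => n /andP[-> _].
Qed.

Lemma le_unbounded_sum u v m : (forall n, 0 <= v n) -> (forall n, (m <= n)%N -> u n <= v n) ->
  unbounded_sum u -> unbounded_sum v.
Proof.
move=> v0 uv hu M.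
have [N hN] := hu (M + \sum_(0 <= n < m) `|u n|).
exists (maxn m N).
have -> : M = M + \sum_(0 <= n < m) `|u n| - \sum_(0 <= n < m) `|u n| by rewrite addrK.
rewrite ltrBlDr; apply: lt_le_trans hN _.
have le1 : \sum_(0 <= n < N) u n <= \sum_(0 <= n < N) (v n + if (n < m)%N then `|u n| else 0).
  apply: ler_sum_nat => n _; case: (ltnP n m) => nm; last by rewrite addr0 uv.
  by apply: le_trans (ler_norm _) _; rewrite lerDr.
apply: le_trans le1 _; rewrite big_split/= lerD//.
  rewrite [leRHS](@big_cat_nat _ _ _ N)//= ?leq_maxr// lerDl; exact: sumr_ge0.
case: (leqP N m) => Nm.
  rewrite [leRHS](@big_cat_nat _ _ _ N)//=; apply: ler_wpDr; first exact: sumr_ge0.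
  by apply: ler_sum_nat => n /andP[_ nN]; rewrite (leq_trans nN Nm).
rewrite (@big_cat_nat _ _ _ m)//= ?(ltnW Nm)// [X in _ + X]big1_seq ?addr0.
  by apply: ler_sum_nat => n /andP[_ ->].
by move=> n /=; rewrite mem_index_iota => /andP[mn _]; rewrite ltnNge mn.
Qed.

Lemma unbounded_sum_dvg u v m : (forall n, (m <= n)%N -> 0 <= v n) ->
  (forall n, (m <= n)%N -> u n <= v n) -> unbounded_sum u ->
  ~ cvgn (fun N => \sum_(m <= n < N) v n).
Proof.
move=> v0 uv hu cv.
have : unbounded_sum (fun n => if (m <= n)%N then v n else 0).
  apply: (@le_unbounded_sum u _ m _ _ hu) => n; first by case: ifP => // /v0.
  by move=> mn; rewrite mn uv.
move=> /(_ (limn (fun N => \sum_(m <= n < N) v n))) [N]; apply/negP; rewrite -leNgt.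
have nd : nondecreasing_seq (fun N => \sum_(m <= n < N) v n).
  apply/nondecreasing_seqP => K; case: (leqP m K) => mK; last by rewrite !big_geq// ltnW.
  by rewrite big_nat_recr//= lerDl v0.
apply: le_trans (nondecreasing_cvgn_le nd cv (maxn m N)).
rewrite (@le_trans _ _ (\sum_(0 <= n < maxn m N) (if (m <= n)%N then v n else 0)))//.
  rewrite [leRHS](@big_cat_nat _ _ _ N)//= ?leq_maxr// lerDl.
  by apply: sumr_ge0 => n _; case: ifP => // /v0.
rewrite (@big_cat_nat _ _ _ m)//= ?leq_maxl// [X in X + _]big1_seq ?add0r; last first.
  by move=> n /=; rewrite mem_index_iota => /andP[_ nm]; rewrite leqNgt nm.
by apply: ler_sum_nat => n /andP[-> _].
Qed.

Lemma unbounded_sum_split u P : (forall n, 0 <= u n) -> unbounded_sum u ->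
  unbounded_sum (fun n => if P n then u n else 0) \/
  unbounded_sum (fun n => if P n then 0 else u n).
Proof.
move=> u0 hu; apply: contrapT => /not_orP[/existsNP [M1 /forallNP h1] /existsNP [M2 /forallNP h2]].
have [N] := hu (M1 + M2); apply/negP; rewrite -leNgt.
have -> : \sum_(0 <= n < N) u n = \sum_(0 <= n < N) (if P n then u n else 0) +
    \sum_(0 <= n < N) (if P n then 0 else u n).
  by rewrite -big_split/=; apply: eq_bigr => n _; case: ifP; rewrite ?addr0 ?add0r.
by apply: lerD; [have /negP := h1 N|have /negP := h2 N]; rewrite -leNgt.
Qed.

Definition block_index (n : nat) : nat := trunc_log 2 (trunc_log 2 n).

Lemma block_indexE h n : n \in block h -> block_index n = h.
Proof.
rewrite mem_block => /andP[h1 h2]; apply: trunc_log_eq => //.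
have n0 : (0 < n)%N by apply: leq_trans h1; rewrite expn_gt0.
apply/andP; split; first exact: trunc_log_max.
rewrite -(@ltn_exp2l 2)//; apply: leq_ltn_trans h2; exact: trunc_logP.
Qed.

(* One factor [2^block_index n] makes the sum over the blocks converge, the other pays for the
   rescaling in [restrict_scale]. *)
Definition damped (q : nat) psi (n : nat) : R :=
  rho n * psi n / 2 ^+ (num_scales q (block_index n) + 2 * block_index n).

(** If all blocks from [h0] on were lighter, block [h] would contribute at most [2^-h] to the damped
    sum, which would be bounded. *)
Lemma heavy_block q psi : (forall n, 0 <= psi n) -> unbounded_sum (damped q psi) ->
  forall h0, exists2 h, (h0 <= h)%N &
    2 ^+ (num_scales q h + h) <= \sum_(n <- block h) rho n * psi n.
Proof.
move=> psi0 hu h0; apply: contrapT => /forall2NP hh.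
have d0 n : 0 <= damped q psi n.
  by rewrite /damped divr_ge0 ?exprn_ge0// mulr_ge0// phi_ratio_ge0.
pose S h := \sum_(0 <= n < 2 ^ (2 ^ h)) damped q psi n.
have step h : (h0 <= h)%N -> S h.+1 <= S h + (2 ^+ h)^-1.
  move=> hh0; have le2 : (2 ^ (2 ^ h) <= 2 ^ (2 ^ h.+1))%N by rewrite leq_exp2l// leq_exp2l.
  rewrite /S (@big_cat_nat _ _ _ (2 ^ (2 ^ h)))//= lerD2l.
  have [//|/negP] := hh h; rewrite -ltNge => lt.
  have -> : \sum_(2 ^ 2 ^ h <= i < 2 ^ 2 ^ h.+1) damped q psi i =
      (\sum_(n <- block h) rho n * psi n) / 2 ^+ (num_scales q h + 2 * h).
    rewrite mulr_suml -/(block h) big_seq [RHS]big_seq; apply: eq_bigr => n nh.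
    by rewrite /damped (block_indexE nh).
  rewrite ler_pdivrMr ?exprn_gt0//; apply: le_trans (ltW lt) _.
  by rewrite mul2n -addnn addnA [X in _ <= _ * X]exprD [leRHS]mulrC -mulrA divff ?mulr1// expf_neq0.
have bound i : S (h0 + i)%N <= S h0 + 2 - 2 / 2 ^+ i.
  elim: i => [|i IH]; first by rewrite addn0 expr0 divr1 addrK.
  rewrite addnS; apply: le_trans (step _ (leq_addr _ _)) _.
  have : (2 ^+ (h0 + i))^-1 <= (2 ^+ i)^-1 :> R.
    by rewrite lef_pV2 ?posrE ?exprn_gt0// ler_eXn2l ?ltr1n// leq_addl.
  have -> : 2 / 2 ^+ i.+1 = (2 ^+ i)^-1 :> R by rewrite exprS invfM mulrA divff ?mul1r.
  by move: IH; lra.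
have [N] := hu (S h0 + 2); apply/negP; rewrite -leNgt.
apply: (@le_trans _ _ (S (h0 + N)%N)); last first.
  by apply: le_trans (bound N) _; rewrite gerBl divr_ge0// exprn_ge0.
have NN : (N <= 2 ^ (2 ^ (h0 + N)))%N.
  apply: leq_trans (ltnW (ltn_expl N (ltnSn 1))) _; rewrite leq_exp2l//.
  by apply: leq_trans (ltnW (ltn_expl (h0 + N) (ltnSn 1))); rewrite leq_addl.
by rewrite /S [leRHS](@big_cat_nat _ _ _ N)//= lerDl; apply: sumr_ge0.
Qed.

(** With [L = trunc_log 2 h], the iterated logarithms are at least [h / 4] and [L / 4], so the
    exponent is at least [c h L / 16]. One half covers [num_scales] because [q >= 32 / c], the other
    covers [2 h] because [L >= 64 / c]. *)
Lemma damping_weight (c : R) : 0 < c -> exists q h0 : nat, (0 < q)%N /\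
  forall n, (h0 <= block_index n)%N ->
    2 ^+ (num_scales q (block_index n) + 2 * block_index n) <=
    expR (c * ln (ln (n%:R : R)) * ln (ln (ln (n%:R : R)))).
Proof.
move=> c0; pose q := (Num.trunc (32 / c)).+1; pose L0 := (4 + (Num.trunc (64 / c)).+1)%N.
exists q, (2 ^ L0)%N; split => // n hn.
set h := block_index n in hn *; set L := trunc_log 2 h.
have h0 : (0 < h)%N by apply: leq_trans hn; rewrite expn_gt0.
have LL0 : (L0 <= L)%N by exact: trunc_log_max.
have l2 := ln2_ge_half R.
have l2' : ln 2 <= 1 :> R by have := @ln_le_sub1 R 2 ltac:(by []); lra.
have qR : 32 / c <= q%:R by apply: ltW; exact: truncnS_gt.
have LR : 64 / c <= L%:R.
  apply: le_trans (ltW (truncnS_gt (64 / c))) _; rewrite ler_nat.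
  by apply: leq_trans LL0; rewrite /L0 leq_addl.
have L4 : 4 <= L%:R :> R by rewrite ler_nat; apply: leq_trans LL0; rewrite /L0 leq_addr.
have hR : 16 <= h%:R :> R.
  rewrite ler_nat; apply: leq_trans hn; rewrite -[16%N]/(2 ^ 4)%N leq_exp2l//.
have lnh : L%:R * ln 2 <= ln h%:R :> R.
  rewrite mulr_natl -lnXn// -natrX ler_ln ?posrE ?ltr0n ?expn_gt0// ler_nat.
  exact: trunc_logP.
have tl0 : (0 < trunc_log 2 n)%N by rewrite lt0n; apply: contraTneq h0 => e; rewrite /h /block_index e.
have n0 : (0 < n)%N by move: tl0; rewrite trunc_log_gt0 => /andP[_]; lia.
have lnn : 2 ^+ h * ln 2 <= ln n%:R :> R.
  have h1 : (2 ^ (2 ^ h) <= n)%N.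
    by apply: leq_trans (trunc_logP (ltnSn 1) n0); rewrite leq_exp2l// trunc_logP.
  rewrite -natrX mulr_natl -lnXn// -natrX ler_ln ?posrE ?ltr0n ?expn_gt0// ler_nat//.
have p2 : 0 < 2 ^+ h :> R by rewrite exprn_gt0.
have lnn' : 2 ^+ h / 2 <= ln n%:R :> R by apply: le_trans lnn; rewrite ler_wpM2l// ltW.
have llnn : h%:R / 4 <= ln (ln (n%:R : R)).
  have : ln (2 ^+ h / 2) <= ln (ln n%:R) :> R.
    by rewrite ler_ln ?posrE// ?divr_gt0//; apply: lt_le_trans lnn'; rewrite divr_gt0.
  apply: le_trans; rewrite ln_div ?posrE// lnXn// -mulr_natl; nra.
have lllnn : L%:R / 4 <= ln (ln (ln (n%:R : R))).
  have h4 : 0 < h%:R / 4 :> R by lra.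
  have : ln (h%:R / 4) <= ln (ln (ln n%:R)) :> R.
    by rewrite ler_ln ?posrE//; apply: lt_le_trans llnn.
  apply: le_trans; rewrite ln_div ?posrE//; last by lra.
  have -> : ln 4 = 2 * ln 2 :> R.
    by rewrite (_ : 4 = 2 ^+ 2 :> R) ?lnXn ?mulr_natl// expr2; lra.
  have : 0 <= (L%:R - 2) * (ln 2 - 2^-1) :> R by rewrite mulr_ge0; lra.
  move: lnh; move: (L%:R) L4 (ln h%:R) (ln 2) => a L4 b d; lra.
have KR : (num_scales q h)%:R <= h%:R * L%:R / q%:R :> R.
  by rewrite ler_pdivlMr ?ltr0n// -!natrM ler_nat leq_trunc_div.
have -> : 2 ^+ (num_scales q h + 2 * h) = expR ((num_scales q h + 2 * h)%:R * ln 2) :> R.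
  by rewrite mulr_natl -lnXn// lnK// posrE exprn_gt0.
rewrite ler_expR.
have q0 : 0 < q%:R :> R by rewrite ltr0n.
have hL0 : 0 <= h%:R * L%:R :> R by rewrite mulr_ge0.
have b1 : h%:R * L%:R / q%:R <= c * (h%:R * L%:R) / 32 :> R.
  have cq : 0 <= c * q%:R / 32 - 1 by move: qR; rewrite ler_pdivrMr//; lra.
  have := mulr_ge0 hL0 cq; rewrite ler_pdivrMr//; lra.
have b2 : 2 * h%:R <= c * (h%:R * L%:R) / 32.
  have : 64 <= c * L%:R by move: LR; rewrite ler_pdivrMr// mulrC.
  have : 0 <= h%:R :> R by [].
  move: (h%:R) (L%:R) => a b; nra.
apply: (@le_trans _ _ (c * (h%:R / 4) * (L%:R / 4))).
  rewrite natrD natrM; apply: (@le_trans _ _ ((num_scales q h)%:R + 2 * h%:R)).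
    by rewrite ler_piMr// addr_ge0// mulr_ge0.
  lra.
apply: ler_pM => //; first by rewrite mulr_ge0 ?(ltW c0)// divr_ge0.
by rewrite ler_pM2l.
Qed.

End Series.

(** * Symmetries of the approximation sets *)

Section ApproxLineInvariance.
Variable R : realType.
Implicit Type psi : nat -> R.

Lemma approx_line_le psi1 psi2 n x : psi1 n <= psi2 n -> approx_line psi1 n x -> approx_line psi2 n x.
Proof. by move=> h [n0 [a ca xa]]; split => //; exists a => //; exact: lt_le_trans h. Qed.

Lemma coprimez_expnr (a : int) (m k : nat) : coprimez a m -> coprimez a (m ^ k)%N.
Proof. by rewrite !coprimezE; exact: coprimeXr. Qed.

(* If [n = 2^v w] with [w] odd, then [a |-> 2 a + w] preserves coprimality to [n]. *)
Lemma approx_line_double psi n x : approx_line psi n x ->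
  approx_line (fun k => 2 * psi k) n (2 * x + (2 ^+ logn 2 n)^-1).
Proof.
case=> n0 [a ca xa]; split => //.
have [w w2 nE] := pfactor_coprime (isT : prime 2) n0.
set v := logn 2 n in nE *.
have cw : coprimez w 2 by rewrite coprimez_sym.
have := ca; rewrite {1}nE PoszM coprimezMr => /andP[caw _].
exists (2 * a + w).
  rewrite {1}nE PoszM coprimezMr; apply/andP; split.
    rewrite -[w%:Z in X in coprimez X _]mul1r coprimez_addMr coprimezMl caw andbT coprimez_sym//.
  apply: coprimez_expnr.
  by rewrite addrC mulrC coprimez_addMr.
have nR : n%:R = w%:R * 2 ^+ v :> R by rewrite {1}nE natrM natrX.
have e2 : 2 ^+ v != 0 :> R by rewrite expf_neq0.
have -> : (2 * x + (2 ^+ v)^-1) * n%:R - (2 * a + w%:Z)%:~R = 2 * (x * n%:R - a%:~R).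
  by rewrite intrD intrM /= nR -pmulrn; field.
by rewrite normrM normr_nat ltr_pM2l.
Qed.

(* The translation is [a |-> a + n / 2^j], and the even number [n / 2^j] has the same prime
   factors as [n]. *)
Lemma approx_line_small_period psi n j x : (j < logn 2 n)%N ->
  approx_line psi n (x + (2 ^+ j)^-1) <-> approx_line psi n x.
Proof.
move=> jn; have n0 : (0 < n)%N by case: n jn.
have /dvdnP[w nE] : (2 ^ j.+1 %| n)%N by rewrite pfactor_dvdn.
have shift (e a : int) : coprimez a n -> coprimez (a + e * (w * 2)%N%:Z) n.
  have nE' : n = (2 ^ j * (w * 2))%N by rewrite nE expnS; lia.
  rewrite nE' PoszM !coprimezMr coprimez_addMr => /andP[c1 c2]; rewrite c2 andbT.
  apply: coprimez_expnr; rewrite PoszM mulrA coprimez_addMr.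
  by move: c2; rewrite PoszM coprimezMr => /andP[].
have nR : n%:R = (w * 2)%N%:R * 2 ^+ j :> R by rewrite nE expnS mulnA natrM natrX.
have e2 : 2 ^+ j != 0 :> R by rewrite expf_neq0.
have key (y : R) (e a : int) : (y + e%:~R * (2 ^+ j)^-1) * n%:R - (a + e * (w * 2)%N%:Z)%:~R = y * n%:R - a%:~R.
  by rewrite intrD intrM -pmulrn nR; field.
split=> -[_ [a ca xa]]; split => //.
  exists (a + (-1) * (w * 2)%N%:Z); first exact: shift.
  by have := key (x + (2 ^+ j)^-1) (-1) a; rewrite (_ : (-1)%:~R / 2 ^+ j = - (2 ^+ j)^-1) ?addrK => [->//|]; rewrite mulrNz mulNr mul1r.
exists (a + 1 * (w * 2)%N%:Z); first exact: shift.
by have := key x 1 a; rewrite (_ : 1%:~R / 2 ^+ j = (2 ^+ j)^-1) => [->//|]; rewrite mul1r.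
Qed.

(** The numerators congruent to 1 modulo [n] already give centres at distance 1 from each other, and
    the radius [psi n / n] exceeds 1. *)
Lemma approx_line_setT psi n : (0 < n)%N -> n%:R < psi n -> approx_line psi n = setT.
Proof.
move=> n0 hn; apply/seteqP; split => // t _; split => //.
have nR : 0 < n%:R :> R by rewrite ltr0n.
exists (1 + Num.floor (t - n%:R^-1) * n%:Z).
  by rewrite coprimez_addMr /coprimez gcd1z.
apply: le_lt_trans hn.
have /andP[h1 h2] := floor_itv (t - n%:R^-1).
have := ler_wpM2r (ltW nR) h1; have := ler_wpM2r (ltW nR) (ltW h2).
rewrite !intrD intrM -pmulrn mulrBl mulVf ?gt_eqF// mulrDl !mul1r => h3 h4.
by rewrite ler_norml; apply/andP; split; lra.
Qed.

Lemma lim_sup_approx_le psi1 psi2 N : (forall n, (N <= n)%N -> psi1 n <= psi2 n) ->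
  lim_sup_set (approx_line psi1) `<=` lim_sup_set (approx_line psi2).
Proof.
move=> h t tl n _; have [k /= nk tk] := tl (maxn N n) I.
exists k => /=; first by apply: leq_trans nk; exact: leq_maxr.
by apply: approx_line_le tk; apply: h; apply: leq_trans nk; exact: leq_maxl.
Qed.

Lemma lim_sup_approx_map psi1 psi2 (f : R -> R) :
  (forall n x, approx_line psi1 n x -> approx_line psi2 n (f x)) ->
  forall x, lim_sup_set (approx_line psi1) x -> lim_sup_set (approx_line psi2) (f x).
Proof. by move=> h x xl n _; have [k nk xk] := xl n I; exists k => //; exact: h. Qed.

End ApproxLineInvariance.

(** * Full measure on the line *)

Section FullMeasure.
Variable R : realType.
Local Notation mu := (@lebesgue_measure R).
Local Notation rho := (@phi_ratio R).
Implicit Types (psi : nat -> R) (P : pred nat).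

(** Because [block_index] tends to infinity, this is eventually at most [psi] for every fixed [j];
    the doubling map raises [j] by one. *)
Definition restrict_scale psi P (j n : nat) : R :=
  2 ^+ j * ((if P n then psi n else 0) / 2 ^+ block_index n).

Lemma block_index_ge j n : (2 ^ (2 ^ j) <= n)%N -> (j <= block_index n)%N.
Proof. by move=> h; apply: trunc_log_max => //; exact: trunc_log_max. Qed.

Lemma lim_sup_restrict_scale_sub psi P j : (forall n, 0 <= psi n) ->
  lim_sup_set (approx_line (restrict_scale psi P j)) `<=` lim_sup_set (approx_line psi).
Proof.
move=> psi0; apply: (@lim_sup_approx_le _ _ _ (2 ^ (2 ^ j))) => n /block_index_ge jn.
rewrite /restrict_scale; case: ifP => _; last by rewrite mul0r mulr0.
rewrite mulrCA ler_piMr// ler_pdivrMr ?exprn_gt0// mul1r.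
by rewrite ler_eXn2l// ltr1n.
Qed.

(** The surplus [2 ^ h] of a heavy block cancels the division by [2 ^ block_index n], and
    [2 ^ num_scales] remains. The bound is the same for all [P]. *)
Lemma restrict_scale_measure psi P q : (0 < q)%N -> (forall n, 0 <= psi n <= n%:R) ->
  unbounded_sum (fun n => if P n then damped q psi n else 0) ->
  ((core_const R q)%:E <=
    mu (lim_sup_set (approx_line (restrict_scale psi P 0)) `&` `[0%R, 1%R[))%E.
Proof.
move=> q0 hpsi hu; pose f n := if P n then psi n else 0.
have f0 n : 0 <= f n <= n%:R by rewrite /f; case: ifP => // _; rewrite lexx ler0n.
have hf : unbounded_sum (damped q f).
  have -> : damped q f = fun n => if P n then damped q psi n else 0; last by [].
  by apply/funext => n; rewrite /damped /f; case: ifP => // _; rewrite mulr0 mul0r.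
apply: lim_sup_measure_ge => // [n n0|h0].
  have /andP[f1 f2] := f0 n; rewrite /restrict_scale mul1r -/(f n) divr_ge0//= ?exprn_ge0//.
  by apply: le_trans f2; rewrite ler_pdivrMr ?exprn_gt0// ler_peMr// exprn_ege1// ler1n.
have [|h hh hs] := heavy_block _ hf h0; first by move=> n; case/andP: (f0 n).
exists h => //; have -> : \sum_(n <- block h) rho n * restrict_scale psi P 0 n =
    (\sum_(n <- block h) rho n * f n) / 2 ^+ h.
  rewrite mulr_suml big_seq [RHS]big_seq; apply: eq_bigr => n nh.
  by rewrite /restrict_scale mul1r (block_indexE nh) -/(f n) mulrA.
by rewrite ler_pdivlMr ?exprn_gt0// natrX -exprD.
Qed.

Lemma restrict_scale_double psi P v j x : (forall n, P n -> logn 2 n = v) ->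
  lim_sup_set (approx_line (restrict_scale psi P j)) x ->
  lim_sup_set (approx_line (restrict_scale psi P j.+1)) (2 * x + (2 ^+ v)^-1).
Proof.
move=> Pv; apply: (@lim_sup_approx_map _ _ _ (fun x => 2 * x + (2 ^+ v)^-1)) => n y yn.
(* Outside [P] the radius is 0 and the approximation set is empty. *)
have Pn : P n.
  case: yn => _ [a _]; rewrite /restrict_scale; case: ifP => // _.
  by rewrite mul0r mulr0 normr_lt0.
have := approx_line_double yn; rewrite (Pv _ Pn); apply: approx_line_le.
by rewrite /restrict_scale exprS mulrA.
Qed.

Lemma lim_sup_full psi q : (0 < q)%N -> (forall n, 0 <= psi n <= n%:R) ->
  unbounded_sum (damped q psi) ->
  mu (lim_sup_set (approx_line psi) `&` `[0%R, 1%R[) = 1%E.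
Proof.
move=> q0 hpsi hu; have psi0 n : 0 <= psi n by case/andP: (hpsi n).
have d0 n : 0 <= damped q psi n.
  by rewrite /damped divr_ge0 ?exprn_ge0// mulr_ge0// phi_ratio_ge0.
have mT (B : set R) : measurable B -> measurable (B `&` `[0%R, 1%R[).
  by move=> mB; apply: measurableI => //; exact: measurable_itv.
have mL psi' : measurable (lim_sup_set (approx_line psi')) by exact: measurable_lim_sup_approx.
have pL psi' x : lim_sup_set (approx_line psi') (x + 1) <-> lim_sup_set (approx_line psi') x.
  by split=> h n _; have [k nk xk] := h n I; exists k => //; apply/approx_line_periodic.
have c0 := core_const_gt0 R q.
have [[v hv]|/forallNP hv] := pselect (exists v,
    unbounded_sum (fun n => if logn 2 n == v then damped q psi n else 0)).
  (* The union over all [j] is mapped into itself by [x |-> 2 x + 2^-v], since [j] may grow without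
     leaving the limsup set of [psi]. *)
  pose A := \bigcup_j lim_sup_set (approx_line (restrict_scale psi [pred n | logn 2 n == v] j)).
  have mA : measurable A by exact: bigcupT_measurable.
  have AL : A `<=` lim_sup_set (approx_line psi).
    by move=> x [j _]; exact: lim_sup_restrict_scale_sub.
  have A1 : mu (A `&` `[0%R, 1%R[) = 1%E.
    apply: (@forward_invariant_full _ _ ((2 ^+ v)^-1)) => //.
    - by move=> x; split=> -[j _ /pL xj]; exists j.
    - move=> x [j _ xj]; exists j.+1 => //.
      by apply: restrict_scale_double xj => n /eqP.
    - apply: lt_le_trans (le_trans (restrict_scale_measure q0 hpsi hv) _); first by rewrite lte_fin.
      apply: le_measure; rewrite ?inE; [exact: mT|exact: mT|apply: setSI].
      by move=> x xj; exists 0%N.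
  apply/eqP; rewrite eq_le; apply/andP; split.
    have -> : 1%E = mu `[0%R, 1%R[ by rewrite lebesgue_measure_itv/= lte_fin ltr01 -EFinB subr0.
    by apply: le_measure; rewrite ?inE; [exact: mT|exact: measurable_itv|exact: subIsetr].
  rewrite -A1; apply: le_measure; rewrite ?inE; [exact: mT|exact: mT|exact: setSI].
(* No single valuation carries the divergence, so the valuations below [V] can be discarded one at a
   time. *)
have hV V : unbounded_sum (fun n => if (V <= logn 2 n)%N then damped q psi n else 0).
  elim: V => [//|V IH].
  have [|h|h] := unbounded_sum_split (fun n => logn 2 n == V) _ IH.
  - by move=> n; case: ifP.
  - case: (hv V); apply: (@le_unbounded_sum _ _ _ 0) h => n; first by case: ifP.
    by move=> _; case: ifP => // _; case: ifP.
  - apply: (@le_unbounded_sum _ _ _ 0) h => n; first by case: ifP.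
    by move=> _; rewrite ltn_neqAle eq_sym; case: eqP.
apply: (small_periods_full c0) => // j.
exists (lim_sup_set (approx_line (restrict_scale psi [pred n | (j < logn 2 n)%N] 0))); split => //.
- exact: lim_sup_restrict_scale_sub.
- move=> y; have E n : approx_line (restrict_scale psi [pred n | (j < logn 2 n)%N] 0) n (y + (2 ^+ j)^-1)
      <-> approx_line (restrict_scale psi [pred n | (j < logn 2 n)%N] 0) n y.
    have [jn|jn] := boolP (j < logn 2 n)%N; first exact: approx_line_small_period.
    by split=> -[_ [a _]]; rewrite /restrict_scale/= (negbTE jn) mul0r mulr0 normr_lt0.
  by split=> h n _; have [k nk xk] := h n I; exists k => //; apply/E.
- apply: restrict_scale_measure => //; exact: hV.
Qed.

End FullMeasure.

(** * Return to the circle *)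

Section Circle.
Variable R : realType.
Implicit Type psi : nat -> R.

Lemma to_circle_eq (x y : R) : to_circle x = to_circle y <-> exists k : int, x - y = k%:~R.
Proof.
split=> [/eqP|[k e]].
  rewrite -Quotient.idealrBE => /intrP[k ->]; by exists k.
by apply/eqP; rewrite -Quotient.idealrBE; apply/intrP; exists k.
Qed.

Lemma to_circle_approx_set psi n x : approx_set psi n (to_circle x) <-> approx_line psi n x.
Proof.
split=> [[a /= /andP[/andP[a1 an] can] [y hy /to_circle_eq[k yx]]]|[n0 [a can xa]]].
  have n0 : (0 < n)%N by exact: leq_trans an.
  split => //; exists (a%:Z + (- k) * n%:Z).
    by rewrite coprimez_addMr coprimezE.
  have /(approx_itvE _ _ _ n0) : approx_itv (psi n) n a y by [].
  have -> : y = x + k%:~R by rewrite -yx; lra.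
  by rewrite mulrDl intrD intrM mulrNz -!pmulrn; congr (`|_| < _); lra.
(* Reducing [a - 1] instead of [a] puts the representative [b + 1] in the range from 1 to [n] used
   by [approx_set]. *)
pose b := ((a - 1) %% n%:Z)%Z; pose k := ((a - 1) %/ n%:Z)%Z.
have nz : n%:Z != 0 by rewrite eqz_nat -lt0n.
have aE : a = k * n%:Z + b + 1 by rewrite -divz_eq subrK.
have b0 : 0 <= b by exact: modz_ge0.
have bn : b < n%:Z by rewrite ltz_pmod// ltz_nat.
have bE : b = `|b|%N%:Z by rewrite gez0_abs.
exists `|b|%N.+1.
  rewrite /=; apply/andP; split.
    by move: bn; rewrite bE ltz_nat.
  have -> : coprime `|b|%N.+1 n = coprimez (`|b|%N.+1%:Z) n by rewrite coprimezE.
  by move: can; rewrite aE -addrA addrC coprimez_addMr {1}bE -PoszD addn1.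
exists (x - k%:~R); last first.
  by apply/to_circle_eq; exists (- k); rewrite mulrNz; lra.
apply/(approx_itvE _ _ _ n0); move: xa; congr (`|_| < _).
rewrite aE bE !intrD intrM -!pmulrn -natr1 mulrBl; lra.
Qed.

Lemma to_circle_well_approximable psi :
  @to_circle R @^-1` well_approximable psi = lim_sup_set (approx_line psi).
Proof.
apply/seteqP; split => x h n _; have [k nk xk] := h n I; exists k => //.
  exact/to_circle_approx_set.
exact/to_circle_approx_set.
Qed.

(** If [psi n > n] for infinitely many [n], the limsup set is everything. Otherwise cutting [psi]
    down to the indices with [psi n <= n] changes finitely many terms and gives the bound that keeps
    intervals within [[-1, 2[]. *)
Lemma circle_measure_full (psi : nat -> R) (q : nat) :
  (0 < q)%N -> (forall n, (0 < n)%N -> 0 <= psi n) ->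
  unbounded_sum (damped q (fun n => if (0 < n)%N then psi n else 0)) ->
  circle_measure (well_approximable psi) = 1%E.
Proof.
move=> q0 psi0 hu; rewrite /circle_measure to_circle_well_approximable setIC.
have I1 : lebesgue_measure `[0%R, 1%R[%classic = 1%E :> \bar R.
  by rewrite lebesgue_measure_itv/= lte_fin ltr01 -EFinB subr0.
have [big|/existsNP [N hN]] := pselect (forall N, exists2 n, (N <= n)%N & n%:R < psi n).
  rewrite (_ : lim_sup_set _ = setT) ?setTI//; apply/seteqP; split => // x _ n _.
  have [k nk pk] := big n.+1; exists k => /=; first exact: ltnW.
  by rewrite approx_line_setT//; apply: leq_ltn_trans nk.
pose f n := if (0 < n)%N && (psi n <= n%:R) then psi n else 0.
have f0 n : 0 <= f n <= n%:R.
  by rewrite /f; case: ifP => [/andP[n0 ->]|_]; rewrite ?psi0// lexx ler0n.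
have ff n : (N.+1 <= n)%N -> f n = if (0 < n)%N then psi n else 0.
  move=> Nn; rewrite /f (leq_ltn_trans _ Nn)//=; case: ifP => // /negbT; rewrite -ltNge => lt.
  by case: hN; exists n => //; exact: ltnW.
have hf : unbounded_sum (damped q f).
  apply: le_unbounded_sum hu; last first.
    by move=> n /ff e; rewrite /damped e.
  move=> n; have /andP[? _] := f0 n.
  by rewrite /damped divr_ge0 ?exprn_ge0// mulr_ge0// phi_ratio_ge0.
have le1 : (lebesgue_measure (lim_sup_set (approx_line psi) `&` `[0%R, 1%R[) <= 1)%E.
  rewrite -I1; apply: le_measure; rewrite ?inE; [|exact: measurable_itv|exact: subIsetr].
  by apply: measurableI; [exact: measurable_lim_sup_approx|exact: measurable_itv].
apply/eqP; rewrite eq_le le1/= -(lim_sup_full q0 f0 hf).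
apply: le_measure; rewrite ?inE; try by apply: measurableI; [exact: measurable_lim_sup_approx|exact: measurable_itv].
apply: setSI; apply: (@lim_sup_approx_le _ _ _ N.+1) => n Nn.
by rewrite ff// (leq_ltn_trans _ Nn).
Qed.

End Circle.

Theorem theorem2 (R : realType) (psi : nat -> R)
  (psi_ge0 : forall n : nat, (0 < n)%N -> 0 <= psi n)
  (c : R) (c_gt0 : 0 < c)
  (div_c : ~ cvgn (fun N : nat => \sum_(16 <= n < N)
     (totient n)%:R * psi n /
     (n%:R * expR (c * ln (ln (n%:R : R)) * ln (ln (ln (n%:R : R))))))) :
  circle_measure (well_approximable psi) = 1%E <->
  ~ cvgn (fun N : nat => \sum_(1 <= n < N) (totient n)%:R / n%:R * psi n).
Proof.
have [q [h0 [q0 hq]]] := damping_weight c_gt0.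
(* [psi 0] has no assumed sign; setting it to 0 gives a function that is nonnegative at every
   index. *)
pose f n := if (0 < n)%N then psi n else 0.
have f0 n : 0 <= f n by rewrite /f; case: ifP => // /psi_ge0.
have d0 n : 0 <= damped q f n.
  by rewrite /damped divr_ge0 ?exprn_ge0// mulr_ge0// phi_ratio_ge0.
have hu : unbounded_sum (damped q f).
  apply: (@le_unbounded_sum _ _ _ (2 ^ (2 ^ h0)) _ _ (unbounded_sum_of_dvg _ div_c)) => //; last first.
    move=> n n16; rewrite divr_ge0 ?mulr_ge0 ?expR_ge0// psi_ge0//.
    exact: leq_trans n16.
  move=> n nh; case: ifP => // n16.
  have n0 : (0 < n)%N by exact: leq_trans n16.
  rewrite /damped /f n0 /phi_ratio invfM mulrACA [X in X <= _]mulrA.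
  rewrite ler_wpM2l ?mulr_ge0 ?psi_ge0// lef_pV2 ?posrE ?expR_gt0 ?exprn_gt0//.
  by apply: hq; exact: block_index_ge.
split=> [_|_]; last exact: circle_measure_full hu.
apply: unbounded_sum_dvg hu => n n1.
  by rewrite mulr_ge0 ?psi_ge0// divr_ge0.
rewrite /damped /f n1 ler_pdivrMr ?exprn_gt0// ler_peMr//.
  by rewrite mulr_ge0 ?psi_ge0// divr_ge0.
by rewrite exprn_ege1// ler1n.
Qed.
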